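(* Let $\Lambda$ be an artin algebra and $\mathcal{T}=\mathsf{Fac}\,T$ a functorially finite torsion class of $\mathsf{mod}\,\Lambda$, where $T$ is a support $\tau$-tilting module. Then the following are equivalent: (1) $\mathcal{T}$ satisfies the Jordan-Hölder property (JHP). (2) The number of isomorphism classes of simple objects in the exact category $\mathcal{T}$ is equal to $|T|$.
   Context: An artin algebra is an algebra over a fixed commutative artinian ring that is finitely generated as a module over it; $\mathsf{mod}\,\Lambda$ is the category of finitely generated right $\Lambda$-modules. $|M|$ is the number of non-isomorphic indecomposable direct summands of $M$. $\mathsf{Fac}\,T$ is the full subcategory of quotients of finite direct sums of copies of $T$. With $\tau$ the Auslander–Reiten translation, a module $T$ is $\tau$-rigid if $\operatorname{Hom}_\Lambda(T,\tau T)=0$, $\tau$-tilting if moreover $|T|=|\Lambda|$, and support $\tau$-tilting if there is an idempotent $e\in\Lambda$ such that $T$ is a $\tau$-tilting $\Lambda/\Lambda e\Lambda$-module. A torsion class of $\mathsf{mod}\,\Lambda$ is the first member $\mathcal{T}$ of a torsion pair $(\mathcal{T},\mathcal{F})$ (i.e. $\operatorname{Hom}(\mathcal{T},\mathcal{F})=0$ and every module $X$ has a short exact sequence $0\to TX\to X\to FX\to0$ with $TX\in\mathcal{T}$, $FX\in\mathcal{F}$). A functorially finite torsion class is of the form $\mathsf{Fac}\,T$ for a support $\tau$-tilting module $T$. $\mathcal{T}$ is extension-closed and is regarded as an exact category whose conflations are the short exact sequences of $\mathsf{mod}\,\Lambda$ with all terms in $\mathcal{T}$. For an exact category $\mathcal{E}$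 and an object $X$, $\mathsf{P}(X)$ is the poset of inflations $A\to X$ up to isomorphism over $X$, with $A\leq B$ if there is an inflation $A\to B$ compatible with the inflations to $X$; $X/A$ is the cokernel of $A\to X$. $X$ is simple if $X\ne 0$ and there is no conflation $L\to X\to N$ with $L,N\neq 0$. $\mathcal{E}$ is length if for every $X$ the lengths of finite chains in $\mathsf{P}(X)$ are bounded (every extension-closed subcategory of $\mathsf{mod}\,\Lambda$ is length). A composition series of $X$ is a finite maximal chain $0=X_0<\cdots<X_n=X$ in $\mathsf{P}(X)$. Two composition series $(X_i)_{i=0}^n$, $(Y_j)_{j=0}^m$ are isomorphic if $m=n$ and there is a permutation $\sigma$ of $\{1,\dots,n\}$ with $X_i/X_{i-1}\cong Y_{\sigma(i)}/Y_{\sigma(i)-1}$ for all $i$. A length exact category satisfies (JHP) if for every object $X$ all composition series of $X$ are isomorphic to each other. *)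

(* Defs.v *)
From HB Require Import structures.
From mathcomp Require Import all_boot all_order all_algebra.

Set Implicit Arguments.
Unset Strict Implicit.
Unset Printing Implicit Defensive.

Import GRing.Theory.
Local Open Scope ring_scope.

(* Conventions.
   - Modules over a ring A are the lmodType's over A.  A right module over L is
     a left module over the converse ring L^c: for m : M and a : L, the element
     m.a is (a : L^c) *: m.  The regular right module is L^c^o.
   - An R-algebra is a ring L : pzRingType together with a ring morphism
     iota : R -> L with central image.  The library's algType is not used
     because it excludes the zero ring, which does occur as a quotient
     L / LeL (for instance for e = 1).
   - Modules are only considered up to isomorphism, so constructions such as
     quotients, Hom-modules and duals are given by predicates characterizing
     their value up to isomorphism, through the maps which identify it. *)

Definition surjective (A B : Type) (f : A -> B) : Prop :=
  forall y, exists x, f x = y.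

Section Modules.
Variable A : pzRingType.
Implicit Types M N P X Y Z tX fX : lmodType A.

Definition zero_module M : Prop := forall x : M, x = 0.

Definition isomorphic M N : Prop := exists f : {linear M -> N}, bijective f.

Definition fin_gen M : Prop :=
  exists (n : nat) (v : 'I_n -> M),
    forall x : M, exists a : 'I_n -> A, x = \sum_i a i *: v i.

Definition hom_zero M N : Prop := forall (f : {linear M -> N}) (x : M), f x = 0.

Definition short_exact X Y Z (f : {linear X -> Y}) (g : {linear Y -> Z}) : Prop :=
  [/\ injective f, surjective g & forall y, g y = 0 <-> exists x, f x = y].

Definition indecomposable M : Prop :=
  ~ zero_module M /\
  forall X Y, isomorphic M (X * Y)%type -> zero_module X \/ zero_module Y.

Definition direct_summand N M : Prop := exists N', isomorphic M (N * N')%type.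

(* The modules satisfying P form exactly n isomorphism classes. *)
Definition num_iso_classes (P : lmodType A -> Prop) (n : nat) : Prop :=
  exists s : 'I_n -> lmodType A,
    [/\ forall i, P (s i),
        forall i j, isomorphic (s i) (s j) -> i = j
      & forall M, P M -> exists i, isomorphic M (s i)].

(* |M| = n *)
Definition num_indec_summands M (n : nat) : Prop :=
  num_iso_classes (fun N => indecomposable N /\ direct_summand N M) n.

Definition Fac (T X : lmodType A) : Prop :=
  exists (n : nat) (f : {linear {ffun 'I_n -> T} -> X}), surjective f.

Definition projective M : Prop :=
  forall X Y (p : {linear X -> Y}) (f : {linear M -> Y}), surjective p ->
  exists g : {linear M -> X}, forall x, p (g x) = f x.

Definition injective_module M : Prop :=
  forall X Y (i : {linear X -> Y}) (f : {linear X -> M}), injective i ->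
  exists g : {linear Y -> M}, forall x, g (i x) = f x.

Definition injective_envelope M N (i : {linear M -> N}) : Prop :=
  [/\ injective_module N, injective i
    & forall Y (h : {linear N -> Y}), injective (fun x => h (i x)) -> injective h].

(* P1 -f-> P0 -g-> M -> 0 is exact with P0 and P1 finitely generated
   projective, and both g : P0 -> M and the corestriction P1 -> Ker g of f are
   essential epimorphisms (that is, projective covers). *)
Definition minimal_projective_presentation P1 P0 M
    (f : {linear P1 -> P0}) (g : {linear P0 -> M}) : Prop :=
  [/\ fin_gen P1 /\ projective P1, fin_gen P0 /\ projective P0,
      surjective g /\ (forall y, g y = 0 <-> exists x, f x = y),
      forall X (h : {linear X -> P0}),
        surjective (fun x => g (h x)) -> surjective h
    & forall X (h : {linear X -> P1}),
        (forall y, g y = 0 -> exists x, f (h x) = y) -> surjective h].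

(* Full subcategories of the category of finitely generated modules. *)
Implicit Types E F : lmodType A -> Prop.

Definition torsion_pair E F : Prop :=
  [/\ forall X, E X -> fin_gen X,
      forall X, F X -> fin_gen X,
      forall X Y, E X -> F Y -> hom_zero X Y
    & forall X, fin_gen X -> exists tX fX (i : {linear tX -> X}) (p : {linear X -> fX}),
        [/\ E tX, F fX & short_exact i p]].

Definition torsion_class E : Prop := exists F, torsion_pair E F.

Definition contravariantly_finite E : Prop :=
  forall X, fin_gen X -> exists (M0 : lmodType A) (f : {linear M0 -> X}), E M0 /\
  forall (M1 : lmodType A) (g : {linear M1 -> X}), E M1 ->
  exists h : {linear M1 -> M0}, forall x, f (h x) = g x.

Definition covariantly_finite E : Prop :=
  forall X, fin_gen X -> exists (M0 : lmodType A) (f : {linear X -> M0}), E M0 /\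
  forall (M1 : lmodType A) (g : {linear X -> M1}), E M1 ->
  exists h : {linear M0 -> M1}, forall x, h (f x) = g x.

Definition functorially_finite E : Prop :=
  contravariantly_finite E /\ covariantly_finite E.

End Modules.

(* The exact category given by an extension-closed subcategory E: the
   conflations are the short exact sequences with all terms in E. *)
Section ExactCategory.
Variables (A : pzRingType) (E : lmodType A -> Prop).
Implicit Types X Y Z L N Q : lmodType A.

Definition conflation X Y Z (f : {linear X -> Y}) (g : {linear Y -> Z}) : Prop :=
  [/\ E X, E Y, E Z & short_exact f g].

Definition inflation X Y (f : {linear X -> Y}) : Prop :=
  exists Z (g : {linear Y -> Z}), conflation f g.

Definition simple_object X : Prop :=
  [/\ E X, ~ zero_module X
    & ~ exists L N (f : {linear L -> X}) (g : {linear X -> N}),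
        [/\ conflation f g, ~ zero_module L & ~ zero_module N]].

(* The elements of the poset P(X), before identification up to isomorphism
   over X. *)
Record admissible_subobject X := AdmissibleSubobject {
  sub_obj : lmodType A;
  sub_map : {linear sub_obj -> X};
  sub_inflation : inflation sub_map }.

Section Subobjects.
Variable X : lmodType A.
Implicit Types B C : admissible_subobject X.

Definition sub_le B C : Prop :=
  exists h : {linear sub_obj B -> sub_obj C},
    inflation h /\ forall x, sub_map C (h x) = sub_map B x.

(* As sub_map is injective, this says that B and C are isomorphic over X. *)
Definition sub_eq B C : Prop := sub_le B C /\ sub_le C B.

Definition sub_lt B C : Prop := sub_le B C /\ ~ sub_le C B.

(* A chain 0 = c_0 < ... < c_n = X which is maximal: an element of P(X) which is
   comparable to every member is itself a member. *)
Definition composition_series n (c : 'I_n.+1 -> admissible_subobject X) : Prop :=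
  [/\ zero_module (sub_obj (c ord0)),
      bijective (sub_map (c ord_max)),
      forall i j : 'I_n.+1, (i < j)%N -> sub_lt (c i) (c j)
    & forall B, (forall i, sub_le B (c i) \/ sub_le (c i) B) ->
        exists i, sub_eq B (c i)].

(* Q is (isomorphic to) C/B, for B <= C. *)
Definition sub_quotient B C (Q : lmodType A) : Prop :=
  exists (h : {linear sub_obj B -> sub_obj C}) (g : {linear sub_obj C -> Q}),
    (forall x, sub_map C (h x) = sub_map B x) /\ conflation h g.

(* For i : 'I_n, the quotient c_(i+1) / c_i. *)
Definition composition_factor n (c : 'I_n.+1 -> admissible_subobject X)
    (i : 'I_n) (Q : lmodType A) : Prop :=
  sub_quotient (c (widen_ord (leqnSn n) i)) (c (lift ord0 i)) Q.

Definition isomorphic_series n (c : 'I_n.+1 -> admissible_subobject X)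
    m (d : 'I_m.+1 -> admissible_subobject X) : Prop :=
  m = n /\
  exists sigma : 'I_n -> 'I_m, bijective sigma /\
    forall i, exists Q Q', [/\ composition_factor c i Q,
      composition_factor d (sigma i) Q' & isomorphic Q Q'].

End Subobjects.

Definition JHP : Prop :=
  forall X, E X ->
  forall n (c : 'I_n.+1 -> admissible_subobject X)
         m (d : 'I_m.+1 -> admissible_subobject X),
    composition_series c -> composition_series d -> isomorphic_series c d.

End ExactCategory.

Section CommutativeRing.
Variable R : comPzRingType.
Implicit Types I K : R -> Prop.

Definition ideal I : Prop :=
  [/\ I 0, forall x y, I x -> I y -> I (x + y) & forall a x, I x -> I (a * x)].

Definition artinian : Prop :=
  forall I : nat -> R -> Prop, (forall k, ideal (I k)) ->
    (forall k x, I k.+1 x -> I k x) ->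
  exists N, forall k, (N <= k)%N -> forall x, I k x <-> I N x.

Definition maximal_ideal I : Prop :=
  [/\ ideal I, ~ I 1
    & forall K, ideal K -> (forall x, I x -> K x) ->
        (forall x, K x -> I x) \/ K 1].

Definition radical (x : R) : Prop := forall I, maximal_ideal I -> I x.

(* J is an injective envelope of R / rad R. *)
Definition dualizing_module (J : lmodType R) : Prop :=
  exists (S : lmodType R) (p : {linear R^o -> S}) (i : {linear S -> J}),
    [/\ surjective p, forall x, p x = 0 <-> radical x & injective_envelope i].

End CommutativeRing.

Section ArtinAlgebras.
Variables (R : comPzRingType) (L : pzRingType) (iota : {rmorphism R -> L}).

Definition artin_algebra : Prop :=
  [/\ artinian R,
      forall (r : R) (a : L), iota r * a = a * iota r
    & exists (n : nat) (v : 'I_n -> L),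
        forall x : L, exists r : 'I_n -> R, x = \sum_i iota (r i) * v i].

(* The left module H is Hom_L(P, L) for the right module P, with the action
   (a.phi)(x) = a * phi x; ev u is the homomorphism corresponding to u. *)
Definition is_star (P : lmodType L^c) (H : lmodType L)
    (ev : H -> {linear P -> L^c^o}) : Prop :=
  [/\ forall u v x, ev (u + v) x = ev u x + ev v x,
      forall (a : L) u x, (ev (a *: u) x : L) = a * (ev u x : L),
      forall u v, (forall x, ev u x = ev v x) -> u = v
    & forall phi : {linear P -> L^c^o}, exists u, forall x, ev u x = phi x].

(* X is Tr M: the cokernel of Hom_L(f, L) : Hom_L(P0, L) -> Hom_L(P1, L) for a
   minimal projective presentation P1 -f-> P0 -> M -> 0. *)
Definition is_transpose (M : lmodType L^c) (X : lmodType L) : Prop :=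
  exists (P1 P0 : lmodType L^c) (f : {linear P1 -> P0}) (g : {linear P0 -> M})
         (H0 H1 : lmodType L)
         (ev0 : H0 -> {linear P0 -> L^c^o}) (ev1 : H1 -> {linear P1 -> L^c^o})
         (fstar : {linear H0 -> H1}) (q : {linear H1 -> X}),
    [/\ minimal_projective_presentation f g, is_star ev0, is_star ev1,
        forall u x, ev1 (fstar u) x = ev0 u (f x)
      & surjective q /\ (forall v, q v = 0 <-> exists u, fstar u = v)].

(* The right module N is D X = Hom_R(X, J) for the left module X, with the
   action (n.a)(x) = n (a x); ev n is the R-linear map corresponding to n. *)
Definition is_dual (J : lmodType R) (X : lmodType L) (N : lmodType L^c)
    (ev : N -> {additive X -> J}) : Prop :=
  [/\ forall n (r : R) x, ev n (iota r *: x) = r *: ev n x,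
      forall m n x, ev (m + n) x = ev m x + ev n x,
      forall (a : L) n x, ev ((a : L^c) *: n) x = ev n (a *: x),
      forall m n, (forall x, ev m x = ev n x) -> m = n
    & forall phi : {additive X -> J},
        (forall (r : R) x, phi (iota r *: x) = r *: phi x) ->
        exists n, forall x, ev n x = phi x].

(* N is (isomorphic to) the Auslander-Reiten translate tau M = D Tr M. *)
Definition is_tau (M N : lmodType L^c) : Prop :=
  exists (X : lmodType L) (J : lmodType R) (ev : N -> {additive X -> J}),
    [/\ is_transpose M X, dualizing_module J & is_dual ev].

Definition tau_rigid (T : lmodType L^c) : Prop :=
  fin_gen T /\ exists tauT : lmodType L^c, is_tau T tauT /\ hom_zero T tauT.

Definition tau_tilting (T : lmodType L^c) : Prop :=
  tau_rigid T /\
  exists n, num_indec_summands T n /\ num_indec_summands (L^c^o : lmodType L^c) n.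

(* x belongs to the two-sided ideal L e L. *)
Definition ideal_generated (e x : L) : Prop :=
  exists (n : nat) (a b : 'I_n -> L), x = \sum_i a i * e * b i.

(* T is (isomorphic to) the restriction of the G-module T' along p : L -> G. *)
Definition restriction_of (G : pzRingType) (p : L -> G)
    (T : lmodType L^c) (T' : lmodType G^c) : Prop :=
  exists h : {additive T -> T'}, bijective h /\
    forall (a : L) (t : T), h ((a : L^c) *: t) = (p a : G^c) *: h t.

End ArtinAlgebras.

(* G, with the projection p, is the quotient algebra L / LeL. *)
Definition support_tau_tilting (R : comPzRingType) (L : pzRingType)
    (iota : {rmorphism R -> L}) (T : lmodType L^c) : Prop :=
  exists e : L, e * e = e /\
  exists (G : pzRingType) (p : {rmorphism L -> G}) (T' : lmodType G^c),
    [/\ surjective p, forall x, p x = 0 <-> ideal_generated e x,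
        restriction_of p T T'
      & tau_tilting (p \o iota : {rmorphism R -> G}) T'].

(* Main.v *)
Require Import Defs.
From HB Require Import structures.
From mathcomp Require Import all_boot all_order all_algebra.
From mathcomp Require Import perm boolp classical_sets.

(* Let T_1, ..., T_n be the indecomposable summands of T.  As T is tau-rigid,
   Ext^1(T, Fac T) = 0, so X |-> h_j(X) = length Hom(T_j, X) is additive on the
   exact category C = Fac T.  If R -> T_i is a radical approximation with R in C
   and tK is the torsion part of its kernel, then h_j([T_i] - [R] + [tK]) is
   nonzero exactly for j = i.  Hence the h_j are independent on K_0(C), which
   is generated by the simple objects: C has at least n simple objects, and if
   it has exactly n then the h_j determine the multiplicities of the factors of
   a composition series, which gives (JHP).

   Conversely, (JHP) makes the multiplicities of the simple objects of C additive
   functions m on C.  For a simple submodule S of X in C, the number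
   m(X) - m(X/S) depends only on S, because any two embeddings S -> X, S -> X'
   have a pushout in C.  Peeling off simple submodules, m is thus determined by
   as many numbers as there are simple modules over G = L/LeL, that is
   |G| = |T| = n.  So C has at most n simple objects. *)

Set Implicit Arguments.
Unset Strict Implicit.
Unset Printing Implicit Defensive.

Import GRing.Theory Num.Theory Defs.
Local Open Scope ring_scope.

(** * Submodules and quotient modules *)

Section LinearMaps.
Variable A : pzRingType.
Implicit Types U V X Y Z : lmodType A.

(** The group K_0(C) is never formed. Its role is played by natural-number-valued functions additive
    on short exact sequences, and by rational matrices of their values on simple objects. All
    lengths are taken over the base ring, the only ring acting on Hom modules, and length is defined
    by chains, so that its additivity does not presuppose a Jordan-Hölder theorem for modules.

    Two obstacles shape the argument. Rigidity of T is a statement over G = L/LeL and not over L; it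
    can be applied because LeL annihilates every object of Fac T, hence every short exact sequence
    inside it. Moreover, neither the kernel of a radical approximation nor a simple submodule of an
    object of C need lie in C. The kernel may be replaced by its torsion part because the latter
    receives the same maps from T. A simple submodule is never evaluated itself: only differences of
    values on objects of C occur, and the pushout that compares two of them is a quotient of a
    direct sum of objects of C. *)

Lemma linear_ofP X Y (f : X -> Y) :
  (forall x y, f (x + y) = f x + f y) -> (forall a x, f (a *: x) = a *: f x) ->
  {g : {linear X -> Y} | forall x, g x = f x}.
Proof.
move=> fD fZ.
have lf : linear f by move=> a x y; rewrite fD fZ.
pose g : {linear X -> Y} := HB.pack f (GRing.isLinear.Build A X Y *:%R f lf).
by exists g.
Qed.

(** Values are unique because the difference of two values at [x] is a value at [0]. This turns maps
    defined through preimages or representatives into linear maps. *)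
Lemma linear_of_rel X Y (r : X -> Y -> Prop) :
  (forall x, exists y, r x y) ->
  (forall x x' y y', r x y -> r x' y' -> r (x + x') (y + y')) ->
  (forall a x y, r x y -> r (a *: x) (a *: y)) ->
  (forall y, r 0 y -> y = 0) ->
  {f : {linear X -> Y} | forall x, r x (f x)}.
Proof.
move=> rT rD rZ r0.
have uniq_r x y y' : r x y -> r x y' -> y = y'.
  move=> h h'; apply/eqP; rewrite -subr_eq0; apply/eqP/r0.
  by rewrite -(subrr x) -scaleN1r -[- y']scaleN1r; apply: rD (rZ _ _ _ h').
have [f fP] := choice rT.
have [g gP] := @linear_ofP _ _ f
  (fun x y => uniq_r _ _ _ (fP (x + y)) (rD _ _ _ _ (fP x) (fP y)))
  (fun a x => uniq_r _ _ _ (fP (a *: x)) (rZ a _ _ (fP x))).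
by exists g => x; rewrite gP.
Qed.

(** Submodules are predicates, so that those of one module can be intersected and compared by
    inclusion; a module type is produced only when one is required. *)
Definition submod V (W : V -> Prop) : Prop :=
  [/\ W 0, forall x y, W x -> W y -> W (x + y) & forall a x, W x -> W (a *: x)].

Section SubType.
Variables (V : lmodType A) (W : V -> Prop) (hW : submod W).

Definition submod_pred of submod W : {pred V} := fun x => `[< W x >].

Fact submod_pred_closed : GRing.submod_closed (submod_pred hW).
Proof.
case: (hW) => W0 WD WZ; split; first exact/asboolP.
by move=> a x y /asboolP hx /asboolP hy; apply/asboolP/WD/hy/WZ.
Qed.

HB.instance Definition _ :=
  GRing.isSubmodClosed.Build A V (submod_pred hW) submod_pred_closed.

Definition submod_type := {x : V | submod_pred hW x}.
HB.instance Definition _ := [isSub of submod_type for @sval _ _].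
HB.instance Definition _ := [Choice of submod_type by <:].
HB.instance Definition _ := [SubChoice_isSubLmodule of submod_type by <:].

Lemma sub_existsP : {S : lmodType A & {i : {linear S -> V} |
  injective i /\ forall x, W x <-> exists s, i s = x}}.
Proof.
exists submod_type, (val : {linear submod_type -> V}); split; first exact: val_inj.
move=> x; split=> [hx|[s <-]]; last by apply/asboolP; exact: (valP s).
have hx' : submod_pred hW x by apply/asboolP.
by exists (Sub x hx' : submod_type).
Qed.

End SubType.

Section QuotType.
Variables (V : lmodType A) (W : V -> Prop) (hW : submod W).

(** [choose] sees only the extension of its predicate once the starting point satisfies it.
    Congruent elements therefore get equal representatives, and the quotient can be the subtype of
    elements fixed by [rep]. *)
Definition coset_rep of submod W := fun x : V => choose (fun y => `[< W (y - x) >]) x.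
Local Notation rep := (coset_rep hW).

Let W0 : W 0. Proof. by case: hW. Qed.
Let WD x y : W x -> W y -> W (x + y). Proof. by case: hW => _ + _; apply. Qed.
Let WZ a x : W x -> W (a *: x). Proof. by case: hW => _ _; apply. Qed.
Let WN x : W x -> W (- x). Proof. by rewrite -scaleN1r; apply: WZ. Qed.

Fact coset_repP x : W (rep x - x).
Proof.
apply/asboolP; rewrite /coset_rep.
by apply: (@chooseP _ (fun y => `[< W (y - x) >])); rewrite subrr; apply/asboolP.
Qed.

Fact coset_rep_eq x y : W (x - y) -> rep x = rep y.
Proof.
move=> h; rewrite /coset_rep.
have e : (fun z => `[< W (z - x) >]) =1 (fun z => `[< W (z - y) >]).
  move=> z; apply/asboolP/asboolP => hz.
    by have := WD hz h; rewrite addrA subrK.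
  by have := WD hz (WN h); rewrite opprB addrA subrK.
rewrite (eq_choose e); apply: choose_id; apply/asboolP => //.
by rewrite subrr.
Qed.

Fact coset_rep_id x : rep (rep x) = rep x.
Proof. exact/coset_rep_eq/coset_repP. Qed.

Definition quot_type := {x : V | rep x == x}.
HB.instance Definition _ := [isSub of quot_type for @sval _ _].
HB.instance Definition _ := [Choice of quot_type by <:].

Definition quot_map (x : V) : quot_type :=
  exist _ (rep x) (introT eqP (coset_rep_id x)).

Fact quot_map_eq x y : quot_map x = quot_map y <-> W (x - y).
Proof.
split=> [/(congr1 val) /= e|/coset_rep_eq e]; last exact: val_inj.
have := WD (WN (coset_repP x)) (coset_repP y).
by rewrite e opprB addrA subrK.
Qed.

Fact quot_map_val (q : quot_type) : quot_map (val q) = q.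
Proof. by apply: val_inj => /=; apply/eqP/(valP q). Qed.

Let add (p q : quot_type) : quot_type := quot_map (val p + val q).
Let opp (p : quot_type) : quot_type := quot_map (- val p).
Let scale (a : A) (p : quot_type) : quot_type := quot_map (a *: val p).

Let addE x y : add (quot_map x) (quot_map y) = quot_map (x + y).
Proof.
apply/quot_map_eq => /=; rewrite opprD addrACA.
exact: WD (coset_repP _) (coset_repP _).
Qed.
Let oppE x : opp (quot_map x) = quot_map (- x).
Proof. by apply/quot_map_eq => /=; rewrite -opprD; apply/WN/coset_repP. Qed.
Let scaleE a x : scale a (quot_map x) = quot_map (a *: x).
Proof. by apply/quot_map_eq => /=; rewrite -scalerBr; apply/WZ/coset_repP. Qed.

Let quotW (P : quot_type -> Prop) : (forall x, P (quot_map x)) -> forall q, P q.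
Proof. by move=> h q; rewrite -(quot_map_val q). Qed.

Let addA : associative add.
Proof. by elim/quotW=> x; elim/quotW=> y; elim/quotW=> z; rewrite !addE addrA. Qed.
Let addC : commutative add.
Proof. by elim/quotW=> x; elim/quotW=> y; rewrite !addE addrC. Qed.
Let add0 : left_id (quot_map 0) add.
Proof. by elim/quotW=> x; rewrite !addE add0r. Qed.
Let addN : left_inverse (quot_map 0) opp add.
Proof. by elim/quotW=> x; rewrite oppE !addE addNr. Qed.

HB.instance Definition _ := GRing.isZmodule.Build quot_type addA addC add0 addN.

Let addrE x y : quot_map x + quot_map y = quot_map (x + y).
Proof. exact: addE. Qed.
Let scaleA a b q : scale a (scale b q) = scale (a * b) q.
Proof. by elim/quotW: q => x; rewrite !scaleE scalerA. Qed.
Let scale1 : left_id 1 scale.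
Proof. by elim/quotW=> x; rewrite scaleE scale1r. Qed.
Let scaleDr : right_distributive scale +%R.
Proof. by move=> a; elim/quotW=> x; elim/quotW=> y; rewrite !(addrE, scaleE, scalerDr). Qed.
Let scaleDl q : {morph scale^~ q : a b / a + b}.
Proof. by elim/quotW: q => x a b; rewrite !(addrE, scaleE, scalerDl). Qed.

HB.instance Definition _ :=
  GRing.Zmodule_isLmodule.Build A quot_type scaleA scale1 scaleDr scaleDl.

Lemma quot_existsP : {Q : lmodType A & {p : {linear V -> Q} |
  surjective p /\ forall x, p x = 0 <-> W x}}.
Proof.
have [p pE] := @linear_ofP V quot_type quot_map
  (fun x y => esym (addE x y)) (fun a x => esym (scaleE a x)).
exists quot_type, p; split=> [|x].
  by elim/quotW=> x; exists x; rewrite pE.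
by rewrite pE -{2}(subr0 x) -quot_map_eq.
Qed.

End QuotType.
End LinearMaps.

Section ModuleMaps.
Variable A : pzRingType.
Implicit Types U V X Y Z : lmodType A.

Lemma inj_surj_bij (S T : Type) (f : S -> T) : injective f -> surjective f -> bijective f.
Proof.
move=> finj fsurj; have [g gP] := choice fsurj.
by exists g => // x; apply: finj; rewrite gP.
Qed.

Lemma bij_surj (S T : Type) (f : S -> T) : bijective f -> surjective f.
Proof. by case=> g _ gK y; exists (g y). Qed.

Lemma linear_inj0 X Y (f : {linear X -> Y}) :
  (forall x, f x = 0 -> x = 0) -> injective f.
Proof.
move=> h x y e; apply/eqP; rewrite -subr_eq0; apply/eqP/h.
by rewrite linearB e subrr.
Qed.

Lemma factor_surj X Y Z (p : {linear X -> Y}) (f : {linear X -> Z}) :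
  surjective p -> (forall x, p x = 0 -> f x = 0) ->
  {g : {linear Y -> Z} | forall x, g (p x) = f x}.
Proof.
move=> ps h.
have [||||g gP] := @linear_of_rel A Y Z (fun y z => exists2 x, p x = y & f x = z).
- by move=> y; have [x <-] := ps y; exists (f x), x.
- by move=> _ _ _ _ [x <- <-] [x' <- <-]; exists (x + x'); rewrite linearD.
- by move=> a _ _ [x <- <-]; exists (a *: x); rewrite linearZ.
- by move=> y [x /h -> <-].
exists g => x; have [x' /eqP] := gP (p x); rewrite -subr_eq0 -linearB => /eqP /h.
by rewrite linearB => /eqP; rewrite subr_eq0 => /eqP -> <-.
Qed.

Lemma factor_inj X Y Z (i : {linear X -> Y}) (f : {linear Z -> Y}) :
  injective i -> (forall z, exists x, i x = f z) ->
  {g : {linear Z -> X} | forall z, i (g z) = f z}.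
Proof.
move=> ii h.
have [||||g gP] := @linear_of_rel A Z X (fun z x => i x = f z); last by exists g.
- exact: h.
- by move=> x x' y y' e e'; rewrite !linearD e e'.
- by move=> a x y e; rewrite !linearZ e.
- by move=> y e; apply: ii; rewrite e !linear0.
Qed.

Lemma linear_bij_inv X Y (f : {linear X -> Y}) : bijective f ->
  {g : {linear Y -> X} | cancel f g & cancel g f}.
Proof.
move=> bf; have [g gP] := factor_inj (f := (idfun : {linear Y -> Y})) (bij_inj bf) (bij_surj bf).
by exists g => // x; apply: (bij_inj bf); rewrite gP.
Qed.

Lemma iso_refl X : isomorphic X X.
Proof. by exists (idfun : {linear X -> X}); exists id. Qed.

Lemma iso_sym X Y : isomorphic X Y -> isomorphic Y X.
Proof. by case=> f /linear_bij_inv [g fg gf]; exists g; exists f. Qed.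

Lemma iso_trans X Y Z : isomorphic X Y -> isomorphic Y Z -> isomorphic X Z.
Proof. by case=> f bf [g bg]; exists (g \o f); apply: bij_comp. Qed.

Lemma iso_zero X Y : isomorphic X Y -> zero_module X -> zero_module Y.
Proof.
by move=> /iso_sym [f bf] X0 y; apply: (bij_inj bf); rewrite linear0; apply: X0.
Qed.

Lemma submodT V : submod (fun _ : V => True).
Proof. by []. Qed.

Lemma submod0 V : submod (fun x : V => x = 0).
Proof.
split=> // [x y -> ->|a x ->]; first by rewrite addr0.
by rewrite scaler0.
Qed.

Lemma submodI V (W W' : V -> Prop) :
  submod W -> submod W' -> submod (fun x => W x /\ W' x).
Proof.
case=> a b c [a' b' c']; split=> //.
  by move=> x y [? ?] [? ?]; split; [apply: b|apply: b'].
by move=> r x [? ?]; split; [apply: c|apply: c'].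
Qed.

Lemma submod_preim V Y (f : {linear V -> Y}) (W : Y -> Prop) :
  submod W -> submod (fun x => W (f x)).
Proof.
case=> a b c; split=> [|x y hx hy|r x hx]; rewrite ?linear0 ?linearD ?linearZ //.
  exact: b.
exact: c.
Qed.

Lemma submod_ker V Y (f : {linear V -> Y}) : submod (fun x => f x = 0).
Proof. exact: (submod_preim _ (submod0 _)). Qed.

Lemma submod_img V Y (f : {linear V -> Y}) (W : V -> Prop) :
  submod W -> submod (fun y => exists2 x, W x & f x = y).
Proof.
case=> a b c; split.
- by exists 0; rewrite ?linear0.
- by move=> _ _ [x hx <-] [y hy <-]; exists (x + y); rewrite ?linearD//; apply: b.
- by move=> r _ [x hx <-]; exists (r *: x); rewrite ?linearZ//; apply: c.
Qed.

Lemma submod_range V Y (f : {linear V -> Y}) : submod (fun y => exists x, f x = y).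
Proof.
have := submod_img f (submodT V).
by congr submod; apply/funext => y; apply/propext; split=> [[x]|[x]]; exists x.
Qed.

Lemma submodB V (W : V -> Prop) x y : submod W -> W x -> W y -> W (x - y).
Proof. by case=> _ WD WZ hx hy; apply: WD => //; rewrite -scaleN1r; apply: WZ. Qed.

Lemma short_exact_quot X Y (f : {linear X -> Y}) : injective f ->
  exists (Q : lmodType A) (p : {linear Y -> Q}), short_exact f p.
Proof. by move=> fi; have [Q [p [ps pE]]] := quot_existsP (submod_range f); exists Q, p. Qed.

Lemma iso_cokernel X Y Z Z' (f : {linear X -> Y}) (g : {linear Y -> Z}) X'
  (f' : {linear X' -> Y}) (g' : {linear Y -> Z'}) :
  short_exact f g -> short_exact f' g' ->
  (forall y, (exists x, f x = y) <-> exists x, f' x = y) -> isomorphic Z Z'.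
Proof.
move=> [_ gs gE] [_ gs' gE'] e.
have gg y : g y = 0 <-> g' y = 0 by rewrite gE gE' e.
have [h hP] := factor_surj gs (fun x => (gg x).1).
exists h; apply: inj_surj_bij => [|z].
  apply: linear_inj0 => y; have [x <-] := gs y.
  by rewrite hP => /gg.
by have [y <-] := gs' z; exists (g y); rewrite hP.
Qed.

End ModuleMaps.

(** * Restriction of scalars *)

Section Restriction.
Variables (A B : pzRingType) (f : {rmorphism A -> B}).

Section Def.
Variable M : lmodType B.

(** The morphism is an argument of the alias so that scalings along different morphisms do not
    clash. *)
Definition restr of {rmorphism A -> B} : Type := M.
Local Notation N := (restr f).

HB.instance Definition _ := GRing.Zmodule.on N.

Let sc (a : A) (x : N) : N := f a *: (x : M).

Let scA a b x : sc a (sc b x) = sc (a * b) x.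
Proof. by rewrite /sc scalerA rmorphM. Qed.
Let sc1 : left_id 1 sc.
Proof. by move=> x; rewrite /sc rmorph1 scale1r. Qed.
Let scDr : right_distributive sc +%R.
Proof. by move=> a x y; rewrite /sc scalerDr. Qed.
Let scDl x : {morph sc^~ x : a b / a + b}.
Proof. by move=> a b; rewrite /sc rmorphD scalerDl. Qed.

HB.instance Definition _ := GRing.Zmodule_isLmodule.Build A N scA sc1 scDr scDl.

Lemma restr_scaleE (a : A) (x : N) : a *: x = f a *: (x : M).
Proof. by []. Qed.

End Def.

Definition Res (M : lmodType B) : lmodType A := restr M f.

Lemma linear_Res (M N : lmodType B) (g : {linear M -> N}) :
  {h : {linear Res M -> Res N} | forall x : M, h x = g x}.
Proof.
apply: linear_ofP => [x y|a x]; first exact: linearD.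
exact: (linearZ_LR g (f a) x).
Qed.

Lemma submod_Res (M : lmodType B) (W : M -> Prop) :
  submod W -> submod (W : Res M -> Prop).
Proof. by case=> W0 WD WZ; split=> // a x; apply: WZ. Qed.

End Restriction.

(** * Length *)

Section Length.
Variable K : pzRingType.
Implicit Types V U : lmodType K.

(** Length at least [n], witnessed by a strictly descending chain of [n] submodules below [W]. Lower
    bounds avoid composition series and the question of their uniqueness. *)
Fixpoint lenge V (n : nat) (W : V -> Prop) : Prop :=
  if n is n'.+1 then exists W' : V -> Prop,
    [/\ submod W', forall x, W' x -> W x, exists2 x, W x & ~ W' x & lenge n' W']
  else True.

Definition fin_len V (W : V -> Prop) : Prop := exists n, ~ lenge n W.

Lemma lenge_sub V (W W' : V -> Prop) n :
  (forall x, W x -> W' x) -> lenge n W -> lenge n W'.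
Proof.
case: n => //= n h [U [sU UW [x Wx Ux] lU]].
by exists U; split=> // [y /UW /h|]//; exists x => //; apply: h.
Qed.

Lemma lenge_le V (W : V -> Prop) m n : (m <= n)%N -> lenge n W -> lenge m W.
Proof.
elim: n m W => [|n IH] [|m] W //= mn [U [sU UW ex lU]].
by exists U; split=> //; apply: IH lU.
Qed.

Lemma fin_len_sub V (W W' : V -> Prop) :
  (forall x, W x -> W' x) -> fin_len W' -> fin_len W.
Proof. by move=> h [n hn]; exists n => /(lenge_sub h). Qed.

Lemma fin_len_max V (W : V -> Prop) : fin_len W ->
  exists n, forall m, lenge m W <-> (m <= n)%N.
Proof.
move=> fW; have ex : exists n, `[< ~ lenge n W >] by case: fW => n hn; exists n; apply/asboolP.
case: (ex_minnP ex) => -[/asboolP/(_ I)//|n] /asboolP hn nmin.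
exists n => m; split=> [hm|hm].
  by rewrite leqNgt; apply/negP => nm; apply: hn; apply: lenge_le hm.
apply: contrapT => hm'; have /nmin : `[< ~ lenge m W >] by apply/asboolP.
by rewrite ltnNge hm.
Qed.

(** Infinite length gets the default value 0, so upper bounds by [ell] are meaningful only together
    with [fin_len]. *)
Definition ell V (W : V -> Prop) : nat :=
  if pselect (exists n, forall m, lenge m W <-> (m <= n)%N) is left h
  then projT1 (cid h) else 0.

Lemma ellP V (W : V -> Prop) n : fin_len W -> lenge n W <-> (n <= ell W)%N.
Proof.
move=> /fin_len_max h; rewrite /ell; case: pselect => // h'.
by case: (cid h').
Qed.

Lemma ell_eq V (W : V -> Prop) n : (forall m, lenge m W <-> (m <= n)%N) -> ell W = n.
Proof.
move=> h; have fW : fin_len W by exists n.+1 => /h; rewrite ltnn.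
apply/eqP; rewrite eqn_leq; apply/andP; split.
  by apply/(h (ell W)); apply/(ellP _ fW).
by apply/(ellP _ fW); apply/(h n).
Qed.

Lemma ell_sub V (W W' : V -> Prop) : fin_len W' ->
  (forall x, W x -> W' x) -> (ell W <= ell W')%N.
Proof.
move=> fW' h; apply/ellP => //; apply: (lenge_sub h); apply/ellP => //.
exact: fin_len_sub h fW'.
Qed.

Lemma ell_proper V (W W' : V -> Prop) x : fin_len W' -> submod W ->
  (forall x, W x -> W' x) -> W' x -> ~ W x -> (ell W < ell W')%N.
Proof.
move=> fW' sW h W'x Wx; apply/ellP => //; exists W; split=> //; first by exists x.
by apply/ellP => //; apply: fin_len_sub h fW'.
Qed.

Lemma ell_sub_eq V (W W' : V -> Prop) : fin_len W' -> submod W ->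
  (forall x, W x -> W' x) -> (ell W' <= ell W)%N -> forall x, W' x -> W x.
Proof.
move=> fW' sW h le x W'x; apply: contrapT => Wx.
by have := ell_proper fW' sW h W'x Wx; rewrite ltnNge le.
Qed.

(** Each strict step of a chain is strict on the kernel part or on the image; conversely a chain of
    the image is pulled back and placed above one of the kernel part. Stated for lower bounds, this
    gives finiteness and additivity of length at once. *)
Lemma lenge_split V U (f : {linear V -> U}) (W : V -> Prop) n : submod W ->
  lenge n W <-> exists a b, [/\ (a + b)%N = n, lenge a (fun x => W x /\ f x = 0)
                              & lenge b (fun y => exists2 x, W x & f x = y)].
Proof.
move=> sW; split.
  elim: n W sW => [|n IH] W sW /=; first by exists 0, 0.
  case=> W' [sW' W'W [x Wx W'x] /(IH _ sW') [a [b [<- la lb]]]].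
  have [[z [Wz fz W'z]]|nz] := EM (exists z, [/\ W z, f z = 0 & ~ W' z]).
    exists a.+1, b; split=> //.
      exists (fun x => W' x /\ f x = 0); split=> //.
      - exact: submodI sW' (submod_ker f).
      - by move=> y [/W'W].
      - by exists z => // -[].
    by apply: lenge_sub lb => _ [y /W'W hy <-]; exists y.
  exists a, b.+1; split; first by rewrite addnS.
    by apply: lenge_sub la => y [/W'W].
  exists (fun y => exists2 x, W' x & f x = y); split=> //.
  - exact: submod_img.
  - by move=> _ [y /W'W hy <-]; exists y.
  - exists (f x); first by exists x.
    case=> x' hx' /eqP; rewrite -subr_eq0 -linearB => /eqP e; apply: nz.
    exists (x' - x); split=> // [|h]; first exact: submodB (W'W _ hx') Wx.
    by apply: W'x; rewrite -[x](subKr x'); apply: submodB.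
case=> a [b []]; elim: b a W n sW => [|b IH] a W n sW <- la /=.
  by move=> _; rewrite addn0; apply: lenge_sub la => x [].
case=> U' [sU' U'f [_ [x Wx <-] U'x] lb]; rewrite addnS.
exists (fun x => W x /\ U' (f x)); split=> [|y []//||].
- exact: submodI (submod_preim f sU').
- by exists x => // -[].
- apply: (IH a) => //; first exact: submodI (submod_preim f sU').
    apply: lenge_sub la => y [Wy fy]; do 2!split=> //.
    by rewrite fy; case: sU'.
  apply: lenge_sub lb => y U'y; have [z Wz fz] := U'f _ U'y.
  by exists z => //; rewrite fz.
Qed.

Section Additivity.
Variables (V U : lmodType K) (f : {linear V -> U}) (W : V -> Prop).
Hypothesis sW : submod W.
Hypotheses (finK : fin_len (fun x => W x /\ f x = 0))
           (finI : fin_len (fun y => exists2 x, W x & f x = y)).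

Let addP m : lenge m W <->
  (m <= ell (fun x => W x /\ f x = 0%R) + ell (fun y => exists2 x, W x & f x = y))%N.
Proof.
split=> [/(lenge_split f _ sW) [a [b [<- la lb]]]|le].
  by apply: leq_add; apply/ellP.
apply: lenge_le le _; apply/(lenge_split f _ sW); do 2!eexists; split=> //; exact/ellP.
Qed.

Lemma fin_len_add : fin_len W.
Proof. by exists (ell (fun x => W x /\ f x = 0%R) + ell (fun y => exists2 x, W x & f x = y)).+1 => /addP; rewrite ltnn. Qed.

Lemma ell_add :
  ell W = (ell (fun x => W x /\ f x = 0%R) + ell (fun y => exists2 x, W x & f x = y))%N.
Proof. exact/ell_eq/addP. Qed.

End Additivity.

Lemma lenge_img V U (f : {linear V -> U}) (W : V -> Prop) n : submod W ->
  lenge n (fun y => exists2 x, W x & f x = y) -> lenge n W.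
Proof. by move=> sW h; apply/(lenge_split f) => //; exists 0, n. Qed.

Lemma fin_len_img V U (f : {linear V -> U}) (W : V -> Prop) : submod W ->
  fin_len W -> fin_len (fun y => exists2 x, W x & f x = y).
Proof. by move=> sW [n hn]; exists n => /(lenge_img sW). Qed.

Lemma ell_additive V U (f : {linear V -> U}) (W : V -> Prop) : submod W -> fin_len W ->
  ell W = (ell (fun x => W x /\ f x = 0%R) + ell (fun y => exists2 x, W x & f x = y))%N.
Proof.
move=> sW fW; apply: ell_add => //; last exact: fin_len_img.
by apply: fin_len_sub fW => x [].
Qed.

Lemma fin_len0 V (W : V -> Prop) : (forall x, W x -> x = 0) -> fin_len W.
Proof.
by move=> h; exists 1%N => -[W' [[W'0 _ _] _ [x /h -> W'x] _]]; apply: W'x.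
Qed.

Lemma ell0 V (W : V -> Prop) : (forall x, W x -> x = 0) -> ell W = 0%N.
Proof.
move=> h; apply/eqP; rewrite -leqn0 leqNgt; apply/negP => /(ellP _ (fin_len0 h)).
by case=> W' [[W'0 _ _] _ [x /h -> W'x] _]; apply: W'x.
Qed.

Lemma ell_inj V U (f : {linear V -> U}) (W : V -> Prop) : submod W ->
  (forall x, W x -> f x = 0 -> x = 0) ->
  fin_len W \/ fin_len (fun y => exists2 x, W x & f x = y) ->
  fin_len W /\ ell (fun y => exists2 x, W x & f x = y) = ell W.
Proof.
move=> sW fi h.
have k0 x : W x /\ f x = 0 -> x = 0 by case; apply: fi.
have fI : fin_len (fun y => exists2 x, W x & f x = y) by case: h => // /fin_len_img; apply.
split; first exact: fin_len_add (fin_len0 k0) fI.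
by rewrite (ell_add sW (fin_len0 k0) fI) (ell0 k0).
Qed.

Lemma eq_ell V (W W' : V -> Prop) : (forall x, W x <-> W' x) -> ell W = ell W'.
Proof. by move=> h; congr ell; apply/funext => x; apply/propext. Qed.

End Length.

(** * Artinian rings *)

Section Generation.
Variable A : pzRingType.
Implicit Types M X Y : lmodType A.

Lemma fin_gen_finType M (I : finType) (v : I -> M) :
  (forall x, exists a : I -> A, x = \sum_i a i *: v i) -> fin_gen M.
Proof.
move=> h; exists #|I|, (fun k => v (enum_val k)) => x.
have [a ->] := h x; exists (fun k => a (enum_val k)).
by rewrite (reindex _ (onW_bij _ (@enum_val_bij I))).
Qed.

Lemma scale_linearP M (v : M) : {f : {linear A^o -> M} | forall a : A, f a = a *: v}.
Proof.
apply: (@linear_ofP A A^o M (fun a : A => a *: v)) => [x y|a x]; first exact: scalerDl.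
by rewrite scalerA.
Qed.

Lemma fin_gen_fin_len M : fin_len (fun _ : A^o => True) -> fin_gen M ->
  fin_len (fun _ : M => True).
Proof.
move=> fA [n]; elim: n M => [|n IH] M [v hv].
  by apply: fin_len0 => x _; have [a ->] := hv x; rewrite big_ord0.
have [g gE] := scale_linearP (v ord0).
have [Q [p [ps pE]]] := quot_existsP (submod_range g).
apply: (@fin_len_add _ _ _ p) => //.
  apply: fin_len_sub (@fin_len_img _ _ _ g _ (submodT _) fA).
  by move=> x [_ /pE [s <-]]; exists s.
have : fin_len (fun _ : Q => True).
  apply: IH; exists (fun i => p (v (lift ord0 i))) => y.
  have [x <-] := ps y; have [a ->] := hv x; exists (fun i => a (lift ord0 i)).
  rewrite linear_sum big_ord_recl /= linearZ /=.
  have -> : p (v ord0) = 0 by apply/pE; exists 1; rewrite gE scale1r.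
  by rewrite scaler0 add0r; apply: eq_bigr => i _; rewrite linearZ.
exact: fin_len_sub.
Qed.

End Generation.

Section Artinian.
Variable R : comPzRingType.
Hypothesis artR : artinian R.

Lemma artinian_min (P : (R -> Prop) -> Prop) (I0 : R -> Prop) : ideal I0 -> P I0 ->
  exists I, [/\ ideal I, P I
    & forall I', ideal I' -> P I' -> (forall x, I' x -> I x) -> forall x, I x -> I' x].
Proof.
move=> iI0 PI0; apply: contrapT => nmin.
pose T := {I : R -> Prop | ideal I /\ P I}.
have step (I : T) : exists J : T, (forall x, sval J x -> sval I x) /\
    ~ (forall x, sval I x -> sval J x).
  apply: contrapT => nJ; apply: nmin; case: I nJ => I [iI PI] /= nJ.
  exists I; split=> // I' iI' PI' sub; apply: contrapT => nsub.
  by apply: nJ; exists (exist _ I' (conj iI' PI')).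
have [next nextP] := choice step.
pose s k := iter k next (exist _ I0 (conj iI0 PI0) : T).
have [||N hN] := artR (I := fun k => sval (s k)).
- by move=> k; case: (svalP (s k)).
- by move=> k; case: (nextP (s k)).
have [_] := nextP (s N); apply=> x hx; exact/(hN N.+1).
Qed.

Lemma mulr_linearP (x : R) : {f : {linear R^o -> R^o} | forall y, f y = x * y}.
Proof.
apply: (@linear_ofP R R^o R^o ( *%R x)) => [y z|a y]; first exact: mulrDr.
by rewrite /GRing.scale /= mulrCA.
Qed.

(** The descending ideals x^k R + Ann(I) stabilize, so x^N = x^(N+1) b + c with c killing [I]. Since
    [x] maps [I] onto itself, every [y] in [I] has the form x^N z, whence b x y = y. *)
Lemma artinian_inv (I : R -> Prop) (x : R) : ideal I ->
  (forall y, I y -> exists2 z, I z & x * z = y) ->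
  exists b, forall y, I y -> b * (x * y) = y.
Proof.
move=> iI xI.
have [||N hN] := artR (I := fun k a => exists b c,
    a = x ^+ k * b + c /\ forall y, I y -> c * y = 0).
- move=> k; split.
  + by exists 0, 0; rewrite mulr0 addr0; split=> // y _; rewrite mul0r.
  + move=> _ _ [b [c [-> hc]]] [b' [c' [-> hc']]]; exists (b + b'), (c + c').
    by split=> [|y hy]; rewrite ?mulrDr ?mulrDl 1?addrACA // hc // hc' // addr0.
  + move=> a _ [b [c [-> hc]]]; exists (a * b), (a * c).
    by split=> [|y hy]; [rewrite mulrDr mulrCA|rewrite -mulrA hc ?mulr0].
- move=> k _ [b [c [-> hc]]]; exists (x * b), c; split=> //.
  by rewrite exprSr mulrA.
have [_ /(_ _) []] := hN N.+1 (leqnSn N) (x ^+ N).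
  by exists 1, 0; rewrite mulr1 addr0; split=> // y _; rewrite mul0r.
move=> b [c [e hc]]; exists b => y Iy.
have xN k z : I z -> exists2 t, I t & x ^+ k * t = z.
  elim: k z => [|k IH] z Iz; first by exists z; rewrite ?mul1r.
  have [t It <-] := xI _ Iz; have [u Iu <-] := IH _ It.
  by exists u => //; rewrite exprS mulrA.
have [z Iz <-] := xN N _ Iy.
rewrite {2}e mulrDl hc // addr0 exprSr !mulrA [b * x]mulrC.
by rewrite -[x * b * _]mulrA [b * _]mulrC !mulrA -exprS -exprSr.
Qed.

(** Otherwise some ideal [I] is minimal among those of infinite length. Every ring element kills [I]
    or is invertible on it, so [I] is a vector space over a field. A complement [U] of a line R v in
    [I] is a smaller ideal, hence of finite length, and then so is [I]. *)
Lemma artinian_fin_len : fin_len (fun _ : R^o => True).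
Proof.
apply: contrapT => nfin.
have iR : ideal (fun _ : R => True) by [].
have [I [iI nI Imin]] := @artinian_min (fun I => ~ fin_len (I : R^o -> Prop)) _ iR nfin.
have proper_fin (U : R^o -> Prop) x : submod U -> (forall y, U y -> I y) -> I x -> ~ U x ->
    fin_len U.
  by move=> sU UI Ix Ux; apply: contrapT => nU; apply: Ux; exact: (Imin U sU nU UI x Ix).
have sI : submod (I : R^o -> Prop) by case: iI.
(* Kernel and image of multiplication by [x] on [I] cannot both have finite length; by minimality,
   one of infinite length is all of [I]. *)
have dich (x : R) : (forall y, I y -> x * y = 0) \/
    (forall y, I y -> exists2 z, I z & x * z = y).
  have [f fE] := mulr_linearP x.
  have [fK|nK] := EM (fin_len (fun y : R^o => I y /\ f y = 0)); last first.
    left=> y Iy; rewrite -fE.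
    by case: (Imin _ (submodI sI (submod_ker f)) nK _ y Iy) => // z [].
  right=> y Iy; have nIm : ~ fin_len (fun y : R^o => exists2 x : R^o, I x & f x = y).
    by move/(fin_len_add sI fK).
  have [|z Iz <-] := Imin _ (submod_img f sI) nIm _ y Iy.
    by case: iI => _ _ IZ _ [z Iz <-]; rewrite fE; apply: IZ.
  by exists z => //; rewrite fE.
have inv (x : R) : (forall y, I y -> x * y = 0) \/
    exists b, forall y, I y -> b * (x * y) = y.
  by case: (dich x) => h; [left|right; apply: artinian_inv].
have [v [Iv v0]] : exists v, I v /\ v <> 0.
  apply: contrapT => nv; apply/nI/fin_len0 => x Ix.
  by apply: contrapT => x0; apply: nv; exists x.
have [I0 ID IZ] := iI.
(* A nonzero s v generates R v, because [s] is then invertible on [I]; so R v has no chain of length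
   2. *)
have fRv : fin_len (fun y : R^o => exists r, r * v = y).
  exists 2%N => -[W [[W0 WD WZ] Wv [_ [r <-] nr] [W' [[W'0 _ _] W'W [y Wy yW'] _]]]].
  apply: nr; have [s e] := Wv _ Wy; subst y.
  case: (inv s) => [h|[b hb]]; first by case: yW'; rewrite h.
  by rewrite -(hb v) //; apply: (WZ r); apply: (WZ b).
(* Membership of 0 is left out because the union of the empty chain is empty; it is recovered below
   from maximality, by comparison with the zero ideal. *)
pose P (U : set R) := [/\ forall x y, U x -> U y -> U (x + y), forall a x, U x -> U (a * x),
  forall x, U x -> I x & ~ U v].
have [|U [[UD UZ UI Uv] Umax]] := @Zorn_bigcup R P.
  move=> F FP tot; split.
  - move=> x y [X FX Xx] [Y FY Yy]; case: (tot X Y FX FY) => sub.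
      by exists Y => //; case: (FP _ FY) => + _ _ _; apply=> //; apply: sub.
    by exists X => //; case: (FP _ FX) => + _ _ _; apply=> //; apply: sub.
  - by move=> a x [X FX Xx]; exists X => //; case: (FP _ FX) => _ + _ _; apply.
  - by move=> x [X FX Xx]; case: (FP _ FX) => _ _ + _; apply.
  - by case=> X FX Xv; case: (FP _ FX).
have U0 : U 0.
  have [[x Ux]|nU] := EM (exists x, U x); first by rewrite -(mul0r x); apply: UZ.
  case: (Umax (fun x => x = 0)).
    split; first by move=> x Ux; case: nU; exists x.
    by move=> h; apply: nU; exists 0; apply: h.
  by split=> [x y -> ->|a x ->|x ->|//]; rewrite ?addr0 ?mulr0.
have sU : submod (U : R^o -> Prop) by split.
have gen w : I w -> exists r, U (w - r * v).
  move=> Iw; have [Uw|nw] := EM (U w); first by exists 0; rewrite mul0r subr0.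
  (* By maximality U + R w contains [v]. The coefficient [r] of [w] cannot kill [I], as [v] is not
     in [U], so it can be inverted to express [w] through [v] modulo [U]. *)
  have [r hr] : exists r, U (v - r * w).
    apply: contrapT => nr; apply: (Umax (fun x => exists r, U (x - r * w))).
      split=> [x Ux|h]; first by exists 0; rewrite mul0r subr0.
      by apply/nw/h; exists 1; rewrite mul1r subrr.
    split=> [x y [r hr] [s hs]|a x [r hr]|x [r /UI hr]|//].
    - by exists (r + s); rewrite mulrDl opprD addrACA; apply: UD.
    - by exists (a * r); rewrite -mulrA -mulrBr; apply: UZ.
    - by rewrite -(subrK (r * w) x); apply: ID => //; apply: IZ.
  case: (inv r) => [h|[b hb]]; first by case: Uv; rewrite -(subr0 v) -(h w).
  exists b; rewrite -{1}(hb w) // -mulrBr; apply: (UZ b).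
  by rewrite -opprB -mulN1r; apply: UZ.
have fU : fin_len (U : R^o -> Prop) by apply: proper_fin Uv.
have [Q [p [ps pE]]] := quot_existsP sU.
apply: nI; apply: (@fin_len_add _ _ _ p) => //; first by apply: fin_len_sub fU => x [_ /pE].
apply: fin_len_sub (@fin_len_img _ _ _ p _ _ fRv).
  move=> _ [x /gen [r hr] <-]; exists (r * v); first by exists r.
  by apply/eqP; rewrite eq_sym -subr_eq0 -linearB; apply/eqP/pE.
split; first by exists 0; rewrite mul0r.
  by move=> _ _ [r <-] [s <-]; exists (r + s); rewrite mulrDl.
by move=> a _ [r <-]; exists (a * r); rewrite -mulrA.
Qed.

End Artinian.

(** * Modules of finite length *)

Section FiniteLength.
Variables (R : comPzRingType) (A : pzRingType) (io : {rmorphism R -> A}).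
Implicit Types L M N X Y Z : lmodType A.

(** Lengths of [A]-modules are measured over [R], on the same scale as lengths of Hom modules, which
    carry only an [R]-action. *)
Definition fl M := fin_len (fun _ : Res io M => True).
Definition mlen M := ell (fun _ : Res io M => True).
Definition slen M (W : M -> Prop) := ell (W : Res io M -> Prop).

Lemma fl_slen M (W : M -> Prop) : fl M -> fin_len (W : Res io M -> Prop).
Proof. exact: fin_len_sub. Qed.

Lemma mlen_add M X (f : {linear M -> X}) : fl M ->
  mlen M = (slen (fun x => f x = 0%R) + slen (fun y => exists x, f x = y))%N.
Proof.
move=> fM; have [g gE] := linear_Res io f.
rewrite /mlen (ell_additive g) //; congr addn; apply: eq_ell => x.
  by rewrite gE; split=> [[]|].
by split=> [[y _ <-]|[y <-]]; exists y.
Qed.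

Lemma slen_img M X (f : {linear M -> X}) (W : M -> Prop) : fl M -> injective f ->
  submod W -> slen (fun y => exists2 x, W x & f x = y) = slen W.
Proof.
move=> fM fi sW; have [g gE] := linear_Res io f.
rewrite /slen; have [||_ <-] := @ell_inj _ _ _ g (W : Res io M -> Prop) (submod_Res io sW).
- by move=> x _; rewrite gE -(linear0 f) => /fi.
- by left; apply: fl_slen.
by apply: eq_ell => y; split=> -[x Wx <-]; exists x.
Qed.

Lemma mlen_range M X (f : {linear M -> X}) : fl M -> injective f ->
  slen (fun y => exists x, f x = y) = mlen M.
Proof.
move=> fM fi; rewrite -[RHS](slen_img fM fi (submodT M)).
by apply: eq_ell => y; split=> [[x <-]|[x _ <-]]; exists x.
Qed.

Lemma mlen_short_exact X Y Z (f : {linear X -> Y}) (g : {linear Y -> Z}) :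
  fl X -> fl Y -> short_exact f g -> mlen Y = (mlen X + mlen Z)%N.
Proof.
move=> fX fY [fi gs gE]; rewrite (mlen_add g) // -(mlen_range fX fi).
by congr addn; apply: eq_ell => y //; split=> // _; apply: gs.
Qed.

Lemma fl_surj X Y (f : {linear X -> Y}) : surjective f -> fl X -> fl Y.
Proof.
move=> fs fX; have [g gE] := linear_Res io f.
apply: fin_len_sub (@fin_len_img _ _ _ g _ (submodT _) fX) => y _.
by have [x <-] := fs y; exists x.
Qed.

Lemma fl_inj X Y (f : {linear X -> Y}) : injective f -> fl Y -> fl X.
Proof.
move=> fi fY; have [g gE] := linear_Res io f.
have [||//] := @ell_inj _ _ _ g _ (submodT _).
  by move=> x _; rewrite gE -(linear0 f) => /fi.
by right; apply: fin_len_sub fY.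
Qed.

Lemma fl_short_exact X Y Z (f : {linear X -> Y}) (g : {linear Y -> Z}) :
  short_exact f g -> fl X -> fl Z -> fl Y.
Proof.
move=> [fi gs gE] fX fZ; have [g' g'E] := linear_Res io g; have [f' f'E] := linear_Res io f.
apply: (@fin_len_add _ _ _ g') => //; last by apply: fin_len_sub fZ.
apply: fin_len_sub (@fin_len_img _ _ _ f' _ (submodT _) fX) => y [_].
by rewrite g'E => /gE [x <-]; exists x.
Qed.

Lemma fl_iso X Y : isomorphic X Y -> fl X -> fl Y.
Proof. by case=> f /bij_surj; apply: fl_surj. Qed.

Lemma mlen_iso X Y : fl X -> isomorphic X Y -> mlen X = mlen Y.
Proof.
move=> fX [f bf]; rewrite -(mlen_range fX (bij_inj bf)).
by apply: eq_ell => y; split=> // _; apply: bij_surj.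
Qed.

Lemma mlen_eq0 M : fl M -> mlen M = 0%N -> zero_module M.
Proof.
move=> fM M0 x; apply: contrapT => x0.
have := @ell_proper _ _ (fun y : Res io M => y = 0) _ x fM (submod0 _).
by rewrite -/(mlen M) M0 => /(_ (fun _ _ => I) I x0).
Qed.

Lemma mlen_ltn X Y (f : {linear X -> Y}) : fl Y -> injective f -> ~ surjective f ->
  (mlen X < mlen Y)%N.
Proof.
move=> fY fi fns; rewrite -(mlen_range (fl_inj fi fY) fi).
have [y ny] : exists y, ~ exists x, f x = y.
  by apply: contrapT => h; apply: fns => y; apply: contrapT => h'; apply: h; exists y.
exact: (@ell_proper _ (Res io Y) _ _ y) (submod_Res io (submod_range f)) _ _ ny.
Qed.

Lemma mlen_geq_bij X Y (f : {linear X -> Y}) : fl Y -> injective f ->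
  (mlen Y <= mlen X)%N -> bijective f.
Proof.
move=> fY fi le; apply: inj_surj_bij => //; apply: contrapT => /(mlen_ltn fY fi).
by rewrite ltnNge le.
Qed.

Lemma fl_max M (P : (M -> Prop) -> Prop) W0 : fl M -> submod W0 -> P W0 ->
  exists W, [/\ submod W, P W & forall W', submod W' -> P W' ->
    (forall x, W x -> W' x) -> forall x, W' x -> W x].
Proof.
move=> fM sW0 P0.
have ex : exists n, `[< exists W, [/\ submod W, P W & slen W = n] >].
  by exists (slen W0); apply/asboolP; exists W0.
have [|n /asboolP [W [sW PW <-]] nmax] := ex_maxnP ex (m := mlen M).
  by move=> n /asboolP [W [_ _ <-]]; apply: ell_sub.
exists W; split=> // W' sW' PW' sub.
apply: (@ell_sub_eq _ (Res io M)) => //; first exact: fl_slen.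
  exact: submod_Res.
by apply: nmax; apply/asboolP; exists W'.
Qed.

Lemma fl_min M (P : (M -> Prop) -> Prop) W0 : fl M -> submod W0 -> P W0 ->
  exists W, [/\ submod W, P W & forall W', submod W' -> P W' ->
    (forall x, W' x -> W x) -> forall x, W x -> W' x].
Proof.
move=> fM sW0 P0.
have ex : exists n, `[< exists W, [/\ submod W, P W & slen W = n] >].
  by exists (slen W0); apply/asboolP; exists W0.
have [n /asboolP [W [sW PW <-]] nmin] := ex_minnP ex.
exists W; split=> // W' sW' PW' sub.
apply: (@ell_sub_eq _ (Res io M)) => //; first exact: fl_slen.
  exact: submod_Res.
by apply: nmin; apply/asboolP; exists W'.
Qed.

Lemma fl_fin_gen M : fl M -> fin_gen M.
Proof.
move=> fM.
pose span n (v : 'I_n -> M) := fun x => exists a : 'I_n -> A, x = \sum_i a i *: v i.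
pose P (W : M -> Prop) := exists n (v : 'I_n -> M), W = span n v.
have sspan n v : submod (span n v).
  split; first by exists (fun=> 0); rewrite big1 // => i _; rewrite scale0r.
    move=> _ _ [a ->] [b ->]; exists (fun i => a i + b i).
    by rewrite -big_split; apply: eq_bigr => i _; rewrite scalerDl.
  move=> r _ [a ->]; exists (fun i => r * a i); rewrite scaler_sumr.
  by apply: eq_bigr => i _; rewrite scalerA.
have [||W [_ [n [v ->]] Wmax]] := @fl_max M P (span 0 (fun _ => 0)) fM.
- exact: sspan.
- by exists 0, (fun _ => 0).
exists n, v => x.
(* Adjoining [x] to the generators of a maximal finitely generated submodule cannot enlarge it. *)
pose v' (i : 'I_n.+1) := if unlift ord0 i is Some j then v j else x.
apply: (Wmax (span n.+1 v')); first exact: sspan.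
- by exists n.+1, v'.
- move=> y [a ->]; exists (fun i => if unlift ord0 i is Some j then a j else 0).
  rewrite big_ord_recl unlift_none scale0r add0r.
  by apply: eq_bigr => i _; rewrite /v' liftK.
- exists (fun i => if unlift ord0 i is Some j then 0 else 1).
  rewrite big_ord_recl /v' unlift_none scale1r big1 ?addr0 // => i _.
  by rewrite liftK scale0r.
Qed.

Lemma fl_simple_sub M : fl M -> ~ zero_module M ->
  exists W : M -> Prop, [/\ submod W, exists2 x, W x & x <> 0
    & forall W', submod W' -> (forall x, W' x -> W x) ->
       (forall x, W' x -> x = 0) \/ (forall x, W x -> W' x)].
Proof.
move=> fM nM.
have [|W [sW exW Wmin]] := fl_min (P := fun W => exists2 x, W x & x <> 0) fM (submodT M).
  apply: contrapT => h; apply: nM => x; apply: contrapT => x0.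
  by apply: h; exists x.
exists W; split=> // W' sW' sub; have [ex|nex] := EM (exists2 x, W' x & x <> 0).
  by right; apply: Wmin.
by left=> x W'x; apply: contrapT => x0; apply: nex; exists x.
Qed.

Lemma iso_prod_sub M (W1 W2 : M -> Prop) : submod W1 -> submod W2 ->
  (forall x, W1 x -> W2 x -> x = 0) -> (forall x, exists y z, [/\ W1 y, W2 z & x = y + z]) ->
  exists (X Y : lmodType A) (i : {linear X -> M}) (j : {linear Y -> M}),
    [/\ isomorphic M (X * Y)%type, injective i, injective j,
        forall x, W1 x <-> exists y, i y = x & forall x, W2 x <-> exists y, j y = x].
Proof.
move=> s1 s2 cap sum.
have [X [i [ii iE]]] := sub_existsP s1; have [Y [j [ji jE]]] := sub_existsP s2.
exists X, Y, i, j; split=> //; apply: iso_sym.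
have [||f fE] := @linear_ofP A (X * Y)%type M (fun u => i u.1 + j u.2).
- by move=> x y; rewrite !linearD addrACA.
- by move=> a x; rewrite !linearZ scalerDr.
exists f; apply: inj_surj_bij.
  apply: linear_inj0 => -[x y]; rewrite fE /= => /eqP; rewrite addr_eq0 => /eqP e.
  have ix0 : i x = 0.
    apply: cap; first by apply/iE; exists x.
    by rewrite e -linearN; apply/jE; exists (- y).
  congr pair; first by apply: ii; rewrite linear0.
  by apply: ji; rewrite linear0; apply: oppr_inj; rewrite -e oppr0.
move=> x; have [y [z [/iE [y' <-] /jE [z' <-] ->]]] := sum x.
by exists (y', z'); rewrite fE.
Qed.

Lemma linear_iterP M (e : {linear M -> M}) k :
  {f : {linear M -> M} | forall x, f x = iter k e x}.
Proof.
elim: k => [|k [f fE]]; first by exists idfun.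
by exists (e \o f) => x; rewrite /= fE.
Qed.

Lemma fl_inj_bij M (e : {linear M -> M}) : fl M -> injective e -> bijective e.
Proof. by move=> fM ei; apply: mlen_geq_bij. Qed.

(** Fitting's lemma: once the images of the powers of [e] are stable, [M] is the direct sum of image
    and kernel of a power, and indecomposability makes one of them zero. *)
Lemma fitting M (e : {linear M -> M}) : fl M -> indecomposable M ->
  bijective e \/ exists k, forall x, iter k e x = 0.
Proof.
move=> fM [_ ind].
pose rg k (y : M) := exists x, iter k e x = y.
have srg k : submod (rg k).
  have [f fE] := linear_iterP e k; have := submod_range f; congr submod.
  by apply/funext => y; apply/propext; split=> -[x <-]; exists x; rewrite fE.
have [_ [_ [k0 ->] kmin]] := fl_min (P := fun W => exists k, W = rg k)
  fM (srg 0%N) (ex_intro _ 0%N erefl).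
(* The exponent has to be positive, so that e x = 0 puts [x] into the kernel of the [k]-th power. *)
pose k := k0.+1; have [f fE] := linear_iterP e k; have [f2 f2E] := linear_iterP e (k + k).
have rgk x : rg k x -> rg (k + k) x.
  case=> z <-; have : rg k0 (iter k e z) by exists (e z); rewrite -iterSr.
  apply: kmin => //; first by exists (k + k)%N.
  by move=> _ [t <-]; exists (iter (k + k - k0) e t); rewrite -iterD subnKC // addSn leqW // leq_addr.
(* [f] and [f2] have the same image, so their nested kernels have the same length and coincide. *)
have ker2 x : f2 x = 0 -> f x = 0.
  apply: (@ell_sub_eq _ (Res io M) (fun x => f x = 0) (fun x => f2 x = 0)).
  - exact: fl_slen.
  - exact: (submod_Res io (submod_ker f)).
  - by move=> y fy; rewrite f2E iterD -!fE fy linear0.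
  - have e1 := mlen_add f fM; have := mlen_add f2 fM; rewrite e1 => /eqP.
    have -> : slen (fun y => exists x, f2 x = y) = slen (fun y => exists x, f x = y).
      apply: eq_ell => y; split=> [[z <-]|[z <-]].
        by exists (f z); rewrite f2E iterD -!fE.
      have [|t <-] := rgk (f z); first by exists z; rewrite fE.
      by exists t; rewrite f2E.
    by rewrite eqn_add2r => /eqP h; rewrite -/(slen (fun x => f x = 0)) h.
have [||X [Y [i [j [iso ii ji iE jE]]]]] := iso_prod_sub (submod_range f) (submod_ker f).
- by move=> _ [y <-] h; apply: ker2; rewrite f2E iterD -!fE.
- move=> x; have [|y hy] := rgk (f x); first by exists x; rewrite fE.
  exists (f y), (x - f y); split; first by exists y.
    by rewrite linearB -hy !fE -iterD subrr.
  by rewrite addrC subrK.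
case: (ind _ _ iso) => z0.
  right; exists k => x; rewrite -fE; have [y <-] : exists y, i y = f x by apply/iE; exists x.
  by rewrite (z0 y) linear0.
left; apply: fl_inj_bij => //; apply: linear_inj0 => x ex.
have [y <-] : exists y, j y = x; last by rewrite (z0 y) linear0.
by apply/jE; rewrite fE iterSr ex; elim: (k0) => //= m ->; rewrite linear0.
Qed.

Lemma nilpotent_sub_bij M (e f : {linear M -> M}) k : fl M ->
  (forall x, iter k e x = 0) -> (forall x, f x = x - e x) -> bijective f.
Proof.
move=> fM ek fE; apply: fl_inj_bij => //; apply: linear_inj0 => x.
rewrite fE => /eqP; rewrite subr_eq0 => /eqP xe.
by rewrite -(ek x); elim: k {ek} => //= k <-.
Qed.

(** The endomorphism ring is local: if [u] inverts [h], then u f + u g = 1, and u f is nilpotent by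
    Fitting's lemma, so u g is bijective. *)
Lemma indec_local M (f g h : {linear M -> M}) : fl M -> indecomposable M ->
  (forall x, h x = f x + g x) -> ~ bijective f -> ~ bijective g -> ~ bijective h.
Proof.
move=> fM iM hE nf ng bh; have [u hu uh] := linear_bij_inv bh.
have comp_bij (v : {linear M -> M}) : bijective (u \o v) -> bijective v.
  by move=> b; apply: (eq_bij (bij_comp bh b)) => x /=; rewrite uh.
have [/comp_bij//|[k nil]] := @fitting _ (u \o f) fM iM.
apply/ng/comp_bij/(nilpotent_sub_bij fM nil) => x /=.
by rewrite -[X in _ = X - _]hu hE linearD addrAC subrr add0r.
Qed.

End FiniteLength.

(** * Lengths of Hom modules *)

Lemma fin_len_ffun (K : pzRingType) (M : lmodType K) n : fin_len (fun _ : M => True) ->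
  fin_len (fun _ : {ffun 'I_n -> M} => True).
Proof.
move=> fM; elim: n => [|n IH].
  by apply: fin_len0 => x _; apply/ffunP => -[].
have [||r rE] := @linear_ofP K {ffun 'I_n.+1 -> M} {ffun 'I_n -> M}
    (fun w => [ffun i => w (lift ord0 i)]).
- by move=> x y; apply/ffunP => i; rewrite !ffunE.
- by move=> a x; apply/ffunP => i; rewrite !ffunE.
have [||c cE] := @linear_ofP K M {ffun 'I_n.+1 -> M}
    (fun x => [ffun i => if unlift ord0 i is Some _ then 0 else x]).
- by move=> x y; apply/ffunP => i; rewrite !ffunE; case: unlift => //; rewrite addr0.
- by move=> a x; apply/ffunP => i; rewrite !ffunE; case: unlift => //; rewrite scaler0.
apply: (@fin_len_add _ _ _ r) => //; last by apply: fin_len_sub IH.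
apply: fin_len_sub (@fin_len_img _ _ _ c _ (submodT _) fM) => w [_ /ffunP w0].
exists (w ord0) => //; apply/ffunP => i; rewrite cE ffunE.
by case: unliftP => [j ->|-> //]; have := w0 j; rewrite rE !ffunE.
Qed.

Section HomLength.
Variables (R : comPzRingType) (A : pzRingType) (io : {rmorphism R -> A}).
Hypothesis cen : forall r a, io r * a = a * io r.
Implicit Types K L M N X Y Z T : lmodType A.
Local Notation fl := (fl io).

Definition generates T (g : {m : nat & 'I_m -> T}) : Prop :=
  forall x : T, exists a : 'I_(tag g) -> A, x = \sum_i a i *: tagged g i.

(** Fixing the generators makes [homspace T X] depend on the two modules alone. The default is the
    empty family, and [gensP] excludes it by finite generation. *)
Definition gens T : {m : nat & 'I_m -> T} :=
  if pselect (exists g, generates (T := T) g) is left h then sval (cid h)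
  else Tagged (fun m => 'I_m -> T) (fun _ : 'I_0 => 0).

Lemma gensP T : fin_gen T -> generates (gens T).
Proof.
move=> [n [v hv]]; rewrite /gens; case: pselect => [h|[]]; first exact: (svalP (cid h)).
by exists (Tagged (fun m => 'I_m -> T) v).
Qed.

Lemma eq_on_gens T X (f g : {linear T -> X}) : fin_gen T ->
  (forall i, f (tagged (gens T) i) = g (tagged (gens T) i)) -> forall x, f x = g x.
Proof.
move=> /gensP gT h x; have [a ->] := gT x; rewrite !linear_sum.
by apply: eq_bigr => i _; rewrite !linearZ h.
Qed.

(* Hom_A(T, X) is encoded as an R-submodule of X ^ m by evaluation at m
   generators of T. *)
Definition homspace T X := {ffun 'I_(tag (gens T)) -> Res io X}.

Definition homv T X (w : homspace T X) : Prop :=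
  exists f : {linear T -> X}, forall i, w i = f (tagged (gens T) i).

(** The image of Hom(T, q), that is, the maps from [T] to [Y] that lift along [q]. *)
Definition homimg T X Y (q : {linear X -> Y}) (w : homspace T Y) : Prop :=
  exists f : {linear T -> X}, forall i, w i = q (f (tagged (gens T) i)).

Definition hl T X := ell (@homv T X).

Lemma scale_homP T X (r : R) (f : {linear T -> X}) :
  {g : {linear T -> X} | forall x, g x = io r *: f x}.
Proof.
apply: linear_ofP => [x y|a x]; first by rewrite linearD scalerDr.
by rewrite linearZ /= !scalerA cen.
Qed.

Lemma submod_homimg T X Y (q : {linear X -> Y}) : submod (@homimg T X Y q).
Proof.
split.
- by exists \0 => i; rewrite ffunE /= linear0.
- by move=> w w' [f hf] [g hg]; exists (f \+ g) => i; rewrite ffunE hf hg -linearD.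
- move=> r w [f hf]; have [g gE] := scale_homP r f; exists g => i.
  by rewrite ffunE hf gE linearZ.
Qed.

Lemma submod_homv T X : submod (@homv T X).
Proof. exact: (submod_homimg T (idfun : {linear X -> X})). Qed.

Lemma fin_homspace T X (W : homspace T X -> Prop) : fl X -> fin_len W.
Proof. by move=> fX; apply: fin_len_sub (fin_len_ffun _ fX). Qed.

Lemma hom_inducedP T X Y (q : {linear X -> Y}) :
  {Q : {linear homspace T X -> homspace T Y} | forall w i, Q w i = q (w i)}.
Proof.
have [||Q QE] := @linear_ofP R (homspace T X) (homspace T Y) (fun w => [ffun i => q (w i)]).
- by move=> w w'; apply/ffunP => i; rewrite !ffunE linearD.
- by move=> r w; apply/ffunP => i; rewrite !ffunE linearZ.
by exists Q => w i; rewrite QE ffunE.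
Qed.

(** Left exactness of Hom(T, -). The last term counts only the liftable maps, so the formula also
    measures the failure of right exactness. *)
Lemma hl_split T K X Y (i : {linear K -> X}) (q : {linear X -> Y}) : fl X -> fin_gen T ->
  injective i -> (forall x, q x = 0 <-> exists k, i k = x) ->
  hl T X = (hl T K + ell (@homimg T X Y q))%N.
Proof.
move=> fX gT ii ker; have [Q QE] := hom_inducedP T q; have [J JE] := hom_inducedP T i.
rewrite /hl (ell_additive Q (submod_homv T X)); last exact: fin_homspace.
congr addn; last first.
  apply: eq_ell => w; split=> [[w' [f hf] <-]|[f hf]].
    by exists f => j; rewrite QE hf.
  exists [ffun j => f (tagged (gens T) j)]; first by exists f => j; rewrite ffunE.
  by apply/ffunP => j; rewrite QE ffunE hf.
have [||_ <-] := @ell_inj _ _ _ J _ (submod_homv T K).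
- move=> w _ /ffunP Jw; apply/ffunP => j; have := Jw j; rewrite JE !ffunE -(linear0 i).
  exact: ii.
- by left; apply: fin_homspace; apply: (fl_inj ii fX).
apply: eq_ell => w; split=> [[[f hf] /ffunP Qw]|[w' [f hf] <-]]; last first.
  split; first by exists (i \o f) => j; rewrite JE hf.
  by apply/ffunP => j; rewrite QE JE ffunE; apply/ker; exists (w' j).
have [x|g gE] := @factor_inj A _ _ _ i f ii.
  apply/ker; apply: (@eq_on_gens T Y (q \o f) \0) => // j.
  by have := Qw j; rewrite QE hf ffunE.
exists [ffun j => g (tagged (gens T) j)]; first by exists g => j; rewrite ffunE.
by apply/ffunP => j; rewrite JE ffunE gE hf.
Qed.

Lemma homimg_lift T X Y (q : {linear X -> Y}) :
  (forall h : {linear T -> Y}, exists g : {linear T -> X}, forall x, q (g x) = h x) ->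
  forall w : homspace T Y, homimg q w <-> homv w.
Proof.
move=> lift w; split=> [[f hf]|[f hf]]; first by exists (q \o f) => i; rewrite hf.
by have [g gE] := lift f; exists g => i; rewrite hf gE.
Qed.

Lemma hl_short_exact T X Y Z (i : {linear X -> Y}) (q : {linear Y -> Z}) :
  fl Y -> fin_gen T -> short_exact i q ->
  (forall h : {linear T -> Z}, exists g : {linear T -> Y}, forall x, q (g x) = h x) ->
  hl T Y = (hl T X + hl T Z)%N.
Proof.
move=> fY gT [ii qs qE] lift; rewrite (hl_split fY gT ii qE).
by congr addn; apply/eq_ell/homimg_lift.
Qed.

Lemma hl_factor T X Y (i : {linear X -> Y}) : fl Y -> fin_gen T -> injective i ->
  (forall h : {linear T -> Y}, exists g : {linear T -> X}, forall x, i (g x) = h x) ->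
  hl T X = hl T Y.
Proof.
move=> fY gT ii lift; have [J JE] := hom_inducedP T i.
rewrite /hl; have [||_ <-] := @ell_inj _ _ _ J _ (submod_homv T X).
- move=> w _ /ffunP Jw; apply/ffunP => j; have := Jw j; rewrite JE !ffunE -(linear0 i).
  exact: ii.
- by left; apply: fin_homspace; apply: (fl_inj ii fY).
apply: eq_ell => w; rewrite -(homimg_lift lift); split=> [[w' [f hf] <-]|[f hf]].
  by exists f => j; rewrite JE hf.
exists [ffun j => f (tagged (gens T) j)]; first by exists f => j; rewrite ffunE.
by apply/ffunP => j; rewrite JE ffunE hf.
Qed.

(** With [u] the inverse of f b, the endomorphism b u f of [N] satisfies f (b u f) = f. It is not
    nilpotent since [f] maps onto a nonzero module, so by Fitting's lemma it is bijective and [f] is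
    injective. *)
Lemma indec_retract M N (b : {linear M -> N}) (f : {linear N -> M}) : fl N ->
  indecomposable N -> ~ zero_module M -> bijective (f \o b) -> bijective f.
Proof.
move=> fN iN nM bfb; have [u uK Ku] := linear_bij_inv bfb.
have fe x : f (b (u (f x))) = f x := Ku (f x).
have fs : surjective f by move=> y; exists (b (u y)); apply: Ku.
have [be|[k nil]] := @fitting _ _ io _ (b \o u \o f) fN iN.
  by apply: inj_surj_bij => // x y e; apply: (bij_inj be); rewrite /= e.
case: nM => y; have [x <-] := fs y.
suff <- : f (iter k (b \o u \o f) x) = f x by rewrite nil linear0.
by elim: k {nil} => //= k; rewrite fe.
Qed.

(** * Approximations of an indecomposable summand by its radical maps *)

Section RadicalApproximation.
Variables (n : nat) (s : 'I_n -> lmodType A) (E : lmodType A -> Prop).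
Hypothesis s_fl : forall i, fl (s i).
Hypothesis s_indec : forall i, indecomposable (s i).
Hypothesis s_noniso : forall i j, isomorphic (s i) (s j) -> i = j.
Hypothesis sE : forall i, E (s i).
Hypothesis EX : forall X Y, E X -> E Y -> E (X * Y)%type.

Definition nonsplit X i (rho : {linear X -> s i}) : Prop :=
  forall a : {linear s i -> X}, ~ bijective (rho \o a).

Let score X i (rho : {linear X -> s i}) : nat :=
  (\sum_j ell (@homimg (s j) X (s i) rho))%N.

(** Choose a nonsplit map with largest [score], which is bounded by the total length of the Hom
    modules into [s i]. If a radical map from some [s j] did not factor, adjoining it as a further
    component would keep the map nonsplit and raise the score. *)
Lemma radical_approximation i : exists (X : lmodType A) (rho : {linear X -> s i}),
  [/\ E X, nonsplit rho
    & forall j (f : {linear s j -> s i}), (i = j -> ~ bijective f) ->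
      exists g : {linear s j -> X}, forall x, rho (g x) = f x].
Proof.
pose Q m := `[< exists (X : lmodType A) (rho : {linear X -> s i}),
  [/\ E X, nonsplit rho & score rho = m] >].
have exQ : exists m, Q m.
  (* The zero endomorphism is nonsplit because [s i] is nonzero, so the maximum is over a nonempty
     set. *)
  exists (score (\0 : {linear s i -> s i})); apply/asboolP.
  exists (s i), \0; split=> // a /bij_inj inj0; case: (s_indec i) => + _; apply=> x.
  exact: inj0.
have [|m /asboolP [X [rho [EX' ns <-]]] mmax] := ex_maxnP exQ (m := \sum_j hl (s j) (s i)).
  move=> m /asboolP [X [rho [_ _ <-]]]; apply: leq_sum => j _.
  apply: ell_sub => [|w [f hf]]; first exact: fin_homspace.
  by exists (rho \o f) => k; rewrite hf.
exists X, rho; split=> // j f nf.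
have [||rho' rhoE] := @linear_ofP A (X * s j)%type (s i) (fun u => rho u.1 + f u.2).
- by move=> x y; rewrite !linearD addrACA.
- by move=> a x; rewrite !linearZ scalerDr.
have ns' : nonsplit rho'.
  move=> a; have [||a1 a1E] := @linear_ofP A _ _ (fun x => (a x).1).
  - by move=> x y; rewrite linearD.
  - by move=> r x; rewrite linearZ.
  have [||a2 a2E] := @linear_ofP A _ _ (fun x => (a x).2).
  - by move=> x y; rewrite linearD.
  - by move=> r x; rewrite linearZ.
  (* A splitting of [rho'] is a sum of two endomorphisms of [s i], so by locality one of them would
     already be bijective. *)
  apply: (@indec_local _ _ io _ (rho \o a1) (f \o a2)) => //.
  - by move=> x /=; rewrite rhoE a1E a2E.
  - exact: ns.
  - move=> b; have [nz _] := s_indec i.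
    have bf := indec_retract (s_fl j) (s_indec j) nz b.
    have e : i = j by apply/esym/s_noniso; exists f.
    exact: nf e bf.
have sub k w : homimg (T := s k) rho w -> homimg (T := s k) rho' w.
  case=> g hg; have [||g' g'E] := @linear_ofP A (s k) (X * s j)%type (fun x => (g x, 0)).
  - by move=> x y; rewrite linearD; congr pair; rewrite addr0.
  - by move=> r x; rewrite linearZ; congr pair; rewrite scaler0.
  by exists g' => l; rewrite rhoE g'E /= linear0 addr0.
apply: contrapT => nfac.
have /mmax : Q (score rho').
  by apply/asboolP; exists (X * s j)%type, rho'; split=> //; apply: EX.
rewrite leqNgt => /negP; apply.
rewrite /score (bigD1 j) //= [X in (_ < X)%N](bigD1 j) //= -addSn; apply: leq_add; last first.
  by apply: leq_sum => k _; apply: ell_sub (sub k); apply: fin_homspace.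
apply: (@ell_proper _ (homspace (s j) (s i)) _ _ [ffun k => f (tagged (gens (s j)) k)]).
- exact: fin_homspace.
- exact: submod_homimg.
- exact: sub.
- have [||g gE] := @linear_ofP A (s j) (X * s j)%type (fun x => (0, x)).
  + by move=> x y; congr pair; rewrite addr0.
  + by move=> r x; congr pair; rewrite scaler0.
  by exists g => k; rewrite ffunE rhoE gE /= linear0 add0r.
- case=> g hg; apply: nfac; exists g.
  apply: (@eq_on_gens _ _ (rho \o g) f); first exact: fl_fin_gen (s_fl j).
  by move=> k; have := hg k; rewrite ffunE.
Qed.

(* In terms of additive functions: the class [s i] - [X] + [Y] pairs with the
   functions hl (s j) to a nonzero multiple of the i-th dual basis vector. *)
Lemma hom_dual_basis F i : (forall M, fin_gen M -> fl M) -> torsion_pair E F ->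
  exists X Y, [/\ E X, E Y,
    forall j, i <> j -> (hl (s j) (s i) + hl (s j) Y = hl (s j) X)%N
  & (hl (s i) X < hl (s i) (s i) + hl (s i) Y)%N].
Proof.
move=> fgfl [Efg _ hom0 tor]; have [X [rho [HX ns rad]]] := radical_approximation i.
have fX : fl X by apply/fgfl/Efg.
have [K [k [ki kE]]] := sub_existsP (submod_ker rho).
have fK : fl K by apply: (fl_inj ki fX).
have [tK [fK' [t [p [HtK HfK [ti ps pE]]]]]] := tor K (fl_fin_gen fK).
have gs j : fin_gen (s j) by apply/Efg/sE.
(* Every map from [s j] to [K] lands in the torsion part [tK], because its composite with the
   torsion-free quotient vanishes. *)
have e j : hl (s j) X = (hl (s j) tK + ell (@homimg (s j) X (s i) rho))%N.
  rewrite (hl_split fX (gs j) ki kE); congr addn; apply/esym/(hl_factor fK (gs j) ti) => h.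
  have [g gE] := @factor_inj A _ _ _ t h ti (fun x =>
    (pE _).1 (hom0 _ _ (sE j) HfK (p \o h) x)).
  by exists g.
exists X, tK; split=> // [j ij|].
  rewrite e addnC; congr addn; apply/esym/eq_ell/homimg_lift => h.
  by apply: rad.
rewrite e addnC ltn_add2r.
(* The identity of [s i] does not lift along the nonsplit map [rho], so the liftable maps form a
   proper submodule. *)
apply: (@ell_proper _ (homspace (s i) (s i)) _ _ [ffun k => tagged (gens (s i)) k]).
- exact: fin_homspace.
- exact: submod_homimg.
- by move=> w [f hf]; exists (rho \o f) => l; rewrite hf.
- by exists idfun => l; rewrite ffunE.
- case=> g hg; apply: (ns g); exists id => x /=.
    by apply: (@eq_on_gens _ _ (rho \o g) idfun) => // l; have := hg l; rewrite ffunE.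
  by apply: (@eq_on_gens _ _ (rho \o g) idfun) => // l; have := hg l; rewrite ffunE.
Qed.

End RadicalApproximation.
End HomLength.

(** * The exact category of a torsion class *)

Section TorsionClass.
Variables (R : comPzRingType) (A : pzRingType) (io : {rmorphism R -> A}).
Hypothesis fgfl : forall M : lmodType A, fin_gen M -> fl io M.
Variables (E F : lmodType A -> Prop).
Hypothesis tor : torsion_pair E F.
Hypothesis Equot : forall (X Y : lmodType A) (p : {linear X -> Y}), surjective p -> E X -> E Y.
Implicit Types K L M N X Y Z Q S : lmodType A.
Local Notation fl := (fl io).
Local Notation mlen := (mlen io).

Lemma E_fl X : E X -> fl X.
Proof. by case: tor => Efg _ _ _ /Efg /fgfl. Qed.

(** The projection of [X] to its torsion-free part is zero, so [X] is a quotient of its torsion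
    part. *)
Lemma E_orthogonal X : fin_gen X -> (forall Y, F Y -> hom_zero X Y) -> E X.
Proof.
case: tor => _ _ _ t /t [tX [fX [i [p [Et Ff [ii ps pE]]]]]] h.
apply: (Equot _ Et) => x; apply/pE.
exact: h.
Qed.

Lemma E_zero X : zero_module X -> E X.
Proof.
move=> X0; apply: E_orthogonal => [|Y _ f x]; last by rewrite (X0 x) linear0.
by exists 0, (fun _ => 0) => x; exists (fun _ => 0); rewrite big_ord0.
Qed.

Lemma E_ext X Y Z (f : {linear X -> Y}) (g : {linear Y -> Z}) :
  short_exact f g -> E X -> E Z -> E Y.
Proof.
move=> ex EX EZ; apply: E_orthogonal => [|V FV u y].
  exact/fl_fin_gen/(fl_short_exact ex (E_fl EX))/E_fl.
have [fi gs gE] := ex; have hom0 : forall X Y, E X -> F Y -> hom_zero X Y by case: tor.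
have [w wE] := factor_surj (f := u) gs (fun x gx =>
  let: ex_intro x' e := (gE x).1 gx in
  eq_trans (congr1 u (esym e)) (hom0 _ _ EX FV (u \o f) x')).
by rewrite -wE; apply: hom0.
Qed.

Lemma E_prod X Y : E X -> E Y -> E (X * Y)%type.
Proof.
move=> EX EY.
have [||i iE] := @linear_ofP A X (X * Y)%type (fun x => (x, 0)).
- by move=> x y; congr pair; rewrite addr0.
- by move=> r x; congr pair; rewrite scaler0.
have [||p pE] := @linear_ofP A (X * Y)%type Y (fun u => u.2) => //.
apply: (@E_ext _ _ _ i p) => //; split.
- by move=> x y; rewrite !iE => -[].
- by move=> y; exists (0, y); rewrite pE.
- move=> [x y]; rewrite pE /=; split=> [->|[x']]; first by exists x; rewrite iE.
  by rewrite iE => -[].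
Qed.

(** Closure under quotients puts the cokernel of any injection into [E]. *)
Lemma inflationP X Y (f : {linear X -> Y}) : inflation E f <-> [/\ E X, E Y & injective f].
Proof.
split=> [[Z [g [EX EY EZ []]]]|[EX EY fi]] //.
have [Q [p ex]] := short_exact_quot fi; exists Q, p; split=> //.
by case: ex => _ ps _; apply: Equot ps EY.
Qed.

Lemma conflationP X Y Z (f : {linear X -> Y}) (g : {linear Y -> Z}) :
  E X -> E Y -> short_exact f g -> conflation E f g.
Proof. by move=> EX EY ex; split=> //; case: ex => _ gs _; apply: Equot gs EY. Qed.

Lemma simple_objectP X : simple_object E X <-> [/\ E X, ~ zero_module X &
  forall L (f : {linear L -> X}), E L -> injective f -> zero_module L \/ surjective f].
Proof.
split=> [[EX nX sX]|[EX nX sX]]; split=> //.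
  move=> L f EL fi; have [Q [p ex]] := short_exact_quot fi.
  have [L0|nL] := EM (zero_module L); first by left.
  right=> x; have [_ ps pE] := ex; apply/pE; apply: contrapT => px.
  apply: sX; by exists L, Q, f, p; split=> //; apply: conflationP.
move=> [L [N [f [g [[EL _ EN [fi gs gE]] nL nN]]]]].
case: (sX _ f EL fi) => // fs; apply: nN => y.
by have [x <-] := gs y; apply/gE/fs.
Qed.

(** Such functions stand in for homomorphisms out of K_0 of the exact category. *)
Definition additive_on (phi : lmodType A -> nat) : Prop :=
  forall X Y Z (f : {linear X -> Y}) (g : {linear Y -> Z}),
    E X -> E Z -> short_exact f g -> phi Y = (phi X + phi Z)%N.

Lemma additive_zero phi X : additive_on phi -> zero_module X -> phi X = 0%N.
Proof.
move=> add X0; have EX := E_zero X0; apply/eqP.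
have := add X X X idfun idfun EX EX; rewrite -{1}[phi X]addn0 => /(_ _)/eqP.
rewrite eqn_add2l eq_sym; apply; split=> // y; first by exists y.
by rewrite (X0 y); split=> // _; exists 0.
Qed.

Lemma additive_iso phi X Y : additive_on phi -> E X -> isomorphic X Y -> phi X = phi Y.
Proof.
move=> add EX [f bf]; have [Q [p ex]] := short_exact_quot (bij_inj bf).
have Q0 : zero_module Q.
  by case: ex => _ ps pE q; have [y <-] := ps q; apply/pE/bij_surj.
by rewrite (add _ _ _ _ _ EX (E_zero Q0) ex) (additive_zero add Q0) addn0.
Qed.

(** * Filtrations with simple factors and their multiplicities *)

Section CompositionMultiplicities.
Variables (n : nat) (S : 'I_n -> lmodType A).

Definition cls X (k : 'I_n) : nat := `[< isomorphic X (S k) >].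

Lemma cls_iso X Y k : isomorphic X Y -> cls X k = cls Y k.
Proof.
move=> iso; rewrite /cls; congr nat_of_bool; apply: asbool_equiv_eq.
by split; apply: iso_trans => //; apply: iso_sym.
Qed.

(** [v] records how often each [S k] occurs among the factors of some filtration by simple objects.
    The family [S] may be incomplete: factors outside it are allowed and not counted. *)
Inductive comp : lmodType A -> ('I_n -> nat) -> Prop :=
| comp_zero X v : zero_module X -> (forall k, v k = 0%N) -> comp X v
| comp_step X Y Q (f : {linear Y -> X}) (g : {linear X -> Q}) v w :
    short_exact f g -> comp Y v -> simple_object E Q ->
    (forall k, w k = (v k + cls Q k)%N) -> comp X w.

Lemma comp_E X v : comp X v -> E X.
Proof.
elim=> [{}X _ X0 _|{}X Y Q f g _ _ ex _ EY [EQ _ _] _]; first exact: E_zero.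
exact: E_ext ex EY EQ.
Qed.

Lemma comp_iso X Y v : isomorphic X Y -> comp X v -> comp Y v.
Proof.
move=> [h bh] cX; case: cX h bh => [{}X {}v X0 v0|{}X Z Q f g v0 {}v [fi gs gE] cZ sQ vE] h bh.
  by apply: comp_zero => //; apply: iso_zero X0; exists h.
have [h' hK h'K] := linear_bij_inv bh.
apply: (@comp_step Y Z Q (h \o f) (g \o h')) cZ sQ vE; split.
- exact: inj_comp (bij_inj bh) fi.
- by move=> q; have [x <-] := gs q; exists (h x); rewrite /= hK.
- move=> y /=; rewrite gE; split=> -[x e]; exists x; first by rewrite e h'K.
  by rewrite -e hK.
Qed.

Lemma comp_exists X : E X -> exists v, comp X v.
Proof.
move: {2}(mlen X).+1 (ltnSn (mlen X)) => m; elim: m X => // m IH X; rewrite ltnS => le EX.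
have [X0|nX] := EM (zero_module X); first by exists (fun=> 0%N); apply: comp_zero.
(* Proper submodules that are images of objects of [E]; the quotient by a maximal one will be simple
   in the exact category. *)
pose P (W : X -> Prop) := (exists x, ~ W x) /\
  exists Y (f : {linear Y -> X}), [/\ E Y, injective f & forall x, W x <-> exists y, f y = x].
have [|W [sW [[x0 nx0] [Y [f [EY fi fE]]]] Wmax]] := fl_max (P := P) (E_fl EX) (submod0 X).
  split; first by apply: contrapT => h; apply: nX => x; apply: contrapT => hx; apply: h; exists x.
  have [Y [f [fi fE]]] := sub_existsP (submod0 X); exists Y, f; split=> //.
  by apply: E_zero => y; apply: fi; rewrite linear0; apply/fE; exists y.
have [Q [g ex]] := short_exact_quot fi; have [_ gs gE] := ex.
have nfs : ~ surjective f by move=> fs; apply/nx0/fE/fs.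
have [v cY] := IH Y (leq_trans (mlen_ltn (E_fl EX) fi nfs) le) EY.
exists (fun k => v k + cls Q k)%N; apply: comp_step ex cY _ _ => //.
apply/simple_objectP; split; first exact: Equot gs EX.
  by move=> Q0; apply/nx0/fE/gE.
move=> L u EL ui.
(* The preimage [V] of [L] in [X] is an extension of [L] by [Y], hence in [E], and maximality of [W]
   applies to it. *)
have sV := submod_preim g (submod_range u).
have [V [i [ii iE]]] := sub_existsP sV.
have [f' f'E] : {f' : {linear Y -> V} | forall y, i (f' y) = f y}.
  apply: factor_inj => // y; apply/iE; exists 0; rewrite linear0; apply/esym/gE.
  by exists y.
have [g' g'E] : {g' : {linear V -> L} | forall y, u (g' y) = g (i y)}.
  by apply: (@factor_inj A _ _ _ u (g \o i)) => // y; apply/iE; exists y.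
have exV : short_exact f' g'.
  split=> [y y' e|l|y]; first by apply: fi; rewrite -!f'E e.
    have [x gx] := gs (u l); have [y iy] : exists y, i y = x by apply/iE; exists l.
    by exists y; apply: ui; rewrite g'E iy.
  split=> [e|[z <-]].
    have /gE [z fz] : g (i y) = 0 by rewrite -g'E e linear0.
    by exists z; apply: ii; rewrite f'E.
  by apply: ui; rewrite g'E f'E linear0; apply/gE; exists z.
have EV := E_ext exV EY EL.
have [us|nus] := EM (surjective u); first by right.
have [q nq] : exists q, ~ exists l, u l = q.
  by apply: contrapT => h; apply: nus => q; apply: contrapT => hq; apply: h; exists q.
left=> l; apply: ui; rewrite linear0.
have [x gx] := gs (u l); rewrite -gx; apply/gE/fE.
apply: (Wmax (fun x => exists l, u l = g x)) => //.
- split; last by exists V, i.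
  by have [z gz] := gs q; exists z; rewrite gz.
- by move=> y /fE [z <-]; exists 0; rewrite linear0; apply/esym/gE; exists z.
- by exists l.
Qed.

(** The filtration of [Z] is pulled back along [g] and placed on top of that of [Y]. *)
Lemma comp_ext X Y Z (f : {linear Y -> X}) (g : {linear X -> Z}) v w :
  short_exact f g -> comp Y v -> comp Z w -> comp X (fun k => v k + w k)%N.
Proof.
move=> ex cY cZ; elim: cZ X f g ex => {Z w} [Z w Z0 w0|Z Z' Q f' g' w' w [f'i g's g'E] _ IH sQ wE] X f g [fi gs gE].
  have -> : (fun k => (v k + w k)%N) = v by apply/funext => k; rewrite w0 addn0.
  apply: comp_iso cY; exists f; apply: inj_surj_bij => // x.
  by apply/gE/Z0.
have [V [i [ii iE]]] := sub_existsP (submod_preim g (submod_range f')).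
have [fV fVE] : {h : {linear Y -> V} | forall y, i (h y) = f y}.
  apply: factor_inj => // y; apply/iE; exists 0; rewrite linear0; apply/esym/gE.
  by exists y.
have [gV gVE] : {h : {linear V -> Z'} | forall y, f' (h y) = g (i y)}.
  by apply: (@factor_inj A _ _ _ f' (g \o i)) => // y; apply/iE; exists y.
apply: (@comp_step X V Q i (g' \o g) (fun k => v k + w' k)%N) sQ _.
- split=> // [q|x].
    by have [z <-] := g's q; have [x <-] := gs z; exists x.
  by rewrite -iE /= g'E.
- apply: (IH _ fV gV); split=> [y y' e|z|y].
  + by apply: fi; rewrite -!fVE e.
  + have [x gx] := gs (f' z); have [y iy] : exists y, i y = x by apply/iE; exists z.
    by exists y; apply: f'i; rewrite gVE iy.
  + split=> [e|[z <-]].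
      have /gE [z fz] : g (i y) = 0 by rewrite -gVE e linear0.
      by exists z; apply: ii; rewrite fVE.
    by apply: f'i; rewrite gVE fVE linear0; apply/gE; exists z.
- by move=> k; rewrite wE addnA.
Qed.

Lemma cls_sum phi X : additive_on phi -> E X ->
  (forall i j, isomorphic (S i) (S j) -> i = j) -> (exists k, isomorphic X (S k)) ->
  (\sum_k cls X k * phi (S k))%N = phi X.
Proof.
move=> add EX inj [k iso]; rewrite (bigD1 k) //= big1 => [|l lk].
  by rewrite /cls (asboolT iso) mul1n addn0 -(additive_iso add EX iso).
rewrite /cls asboolF // => iso'; move/eqP: lk; apply; apply: inj.
exact: iso_trans (iso_sym iso') iso.
Qed.

Lemma comp_additive phi X v : additive_on phi ->
  (forall i j, isomorphic (S i) (S j) -> i = j) ->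
  (forall Q, simple_object E Q -> exists k, isomorphic Q (S k)) ->
  comp X v -> phi X = (\sum_k v k * phi (S k))%N.
Proof.
move=> add inj surj; elim=> {X v} [X v X0 v0|X Y Q f g v w ex cY IH sQ wE].
  by rewrite (additive_zero add X0) big1 // => k _; rewrite v0.
have EQ : E Q by case: sQ.
rewrite (add _ _ _ _ _ (comp_E cY) EQ ex) IH -(cls_sum add EQ inj (surj _ sQ)) -big_split.
by apply: eq_bigr => k _; rewrite wE mulnDl.
Qed.

End CompositionMultiplicities.

(** * Maximal chains of admissible subobjects *)

Section CompositionSeries.
Variable X : lmodType A.
Implicit Types B C D : admissible_subobject E X.

Lemma sub_obj_E B : E (sub_obj B).
Proof. by case: (sub_inflation B) => Z [g [EB _ _ _]]. Qed.

Lemma sub_map_inj B : injective (sub_map B).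
Proof. by case: (sub_inflation B) => Z [g [_ _ _ [fi _ _]]]. Qed.

(** A factorization of one injection through another is itself injective between objects of [E], so
    the order of P(X) is containment of images. *)
Lemma sub_leP B C : sub_le B C <-> forall x, exists y, sub_map C y = sub_map B x.
Proof.
split=> [[h [_ hE]] x|h]; first by exists (h x).
have [g gE] := factor_inj (@sub_map_inj C) h.
exists g; split=> //; apply/inflationP; split; try exact: sub_obj_E.
by move=> x y e; apply: (@sub_map_inj B); rewrite -!gE e.
Qed.

Lemma sub_le_trans B C D : sub_le B C -> sub_le C D -> sub_le B D.
Proof.
move=> /sub_leP h /sub_leP h'; apply/sub_leP => x.
by have [y <-] := h x; apply: h'.
Qed.

Lemma sub_le_refl B : sub_le B B.
Proof. by apply/sub_leP => x; exists x. Qed.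

Lemma admissible_of_inj L (f : {linear L -> X}) : E L -> E X -> injective f ->
  {B : admissible_subobject E X | forall x, (exists y, sub_map B y = x) <-> exists y, f y = x}.
Proof.
move=> EL EX fi; have inf : inflation E f by apply/inflationP.
by exists (AdmissibleSubobject inf).
Qed.

Lemma sub_quotient_iso B C Q Q' : sub_quotient B C Q -> sub_quotient B C Q' -> isomorphic Q Q'.
Proof.
move=> [h [g [hE [_ _ _ ex]]]] [h' [g' [h'E [_ _ _ ex']]]]; apply: iso_cokernel ex ex' _.
have e x : h x = h' x by apply: (@sub_map_inj C); rewrite hE h'E.
by move=> y; split=> -[x <-]; exists x.
Qed.

Section Series.
Variables (n : nat) (c : 'I_n.+1 -> admissible_subobject E X).
Hypothesis cs : composition_series c.

Lemma series_le (i j : 'I_n.+1) : (i <= j)%N -> sub_le (c i) (c j).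
Proof.
rewrite leq_eqVlt => /orP [/eqP /val_inj ->|ij]; first exact: sub_le_refl.
by have [_ _ /(_ _ _ ij) []] := cs.
Qed.

(** A conflation with middle term [Q] and nonzero ends would give, by pulling back to [C], a
    subobject [D] strictly between two consecutive members, against maximality of the chain. *)
Lemma series_factor (i : 'I_n) : exists Q, [/\ composition_factor c i Q, simple_object E Q
  & exists (f : {linear sub_obj (c (widen_ord (leqnSn n) i)) -> sub_obj (c (lift ord0 i))})
           (g : {linear sub_obj (c (lift ord0 i)) -> Q}), short_exact f g].
Proof.
have [_ _ lt cmax] := cs.
set B := c (widen_ord _ i); set C := c (lift ord0 i).
have [BC nCB] : sub_lt B C by apply: lt; rewrite /= /bump add1n.
have EX : E X by case: (sub_inflation B) => Z [g [_ ? _ _]].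
have [h [[Q [g cf]] hE]] := BC.
have [EB EC EQ ex] := cf; have [hi gs gE] := ex.
exists Q; split; [by exists h, g| |by exists h, g].
split=> // [Q0|[L [N [u [w [[EL _ EN [ui ws wE]] nL nN]]]]]].
  by apply/nCB/sub_leP => x; have [y <-] := (gE x).1 (Q0 _); exists y.
have [V [j [ji jE]]] := sub_existsP (submod_preim g (submod_range u)).
have [h' h'E] : {h' : {linear sub_obj B -> V} | forall y, j (h' y) = h y}.
  apply: factor_inj => // y; apply/jE; exists 0; rewrite linear0; apply/esym/gE.
  by exists y.
have [g' g'E] : {g' : {linear V -> L} | forall y, u (g' y) = g (j y)}.
  by apply: (@factor_inj A _ _ _ u (g \o j)) => // y; apply/jE; exists y.
have EV : E V.
  apply: (@E_ext _ _ _ h' g') => //; split=> [y y' e|l|y].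
  + by apply: hi; rewrite -!h'E e.
  + have [x gx] := gs (u l); have [y jy] : exists y, j y = x by apply/jE; exists l.
    by exists y; apply: ui; rewrite g'E jy.
  + split=> [e|[z <-]].
      have /gE [z fz] : g (j y) = 0 by rewrite -g'E e linear0.
      by exists z; apply: ji; rewrite h'E.
    by apply: ui; rewrite g'E h'E linear0; apply/gE; exists z.
have [D DE] := admissible_of_inj EV EX (inj_comp (@sub_map_inj C) ji).
have BD : sub_le B D.
  by apply/sub_leP => x; apply/DE; exists (h' x); rewrite /= h'E.
have DC : sub_le D C.
  by apply/sub_leP => x; have [y <-] := (DE _).1 (ex_intro _ x erefl); exists (j y).
case: (cmax D) => [k|k [Dk kD]].
  have [ki|ik] := leqP k i; [right|left].
    by apply: sub_le_trans BD; apply: series_le.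
  by apply: sub_le_trans DC _; apply: series_le; rewrite /= /bump add1n.
(* [D] is a member of the chain: at or below [B] it forces [L] to be zero, at or above [C] it forces
   [N] to be zero. *)
have [ki|ik] := leqP k i.
  apply: nL => l; apply: ui; rewrite linear0.
  have [x gx] := gs (u l); rewrite -gx; apply/gE.
  have [y jy] : exists y, j y = x by apply/jE; exists l.
  have /sub_leP DB : sub_le D B by apply: sub_le_trans Dk _; apply: series_le.
  have [d dE] : exists d, sub_map D d = sub_map C (j y) by apply/DE; exists y.
  have [b bE] := DB d; exists b; apply: (@sub_map_inj C).
  by rewrite hE bE dE jy.
apply: nN => z; have [q <-] := ws z; have [x <-] := gs q; apply/wE.
have /sub_leP CD : sub_le C D.
  by apply: sub_le_trans kD; apply: series_le; rewrite /= /bump add1n.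
have [d dE] := CD x; have [y /= yE] := (DE _).1 (ex_intro _ d erefl).
by apply/jE; exists y; apply: (@sub_map_inj C); rewrite yE.
Qed.

Lemma series_additive phi (Q : 'I_n -> lmodType A) : additive_on phi ->
  (forall i, composition_factor c i (Q i)) -> phi X = (\sum_i phi (Q i))%N.
Proof.
move=> add fQ; have [z0 top _ _] := cs.
have step (i : 'I_n) : phi (sub_obj (c (lift ord0 i))) =
    (phi (sub_obj (c (widen_ord (leqnSn n) i))) + phi (Q i))%N.
  by have [h [g [_ [EB _ EQ ex]]]] := fQ i; apply: (add _ _ _ _ _ EB EQ ex).
have part m (mn : (m <= n)%N) :
    phi (sub_obj (c (inord m))) = (\sum_(i < n | (i < m)%N) phi (Q i))%N.
  elim: m mn => [|m IH] mn.
    rewrite big_pred0_eq (additive_zero add) //.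
    by have -> : inord 0 = ord0 :> 'I_n.+1 by apply: val_inj; rewrite /= inordK.
  have := step (Ordinal mn).
  have -> : lift ord0 (Ordinal mn) = inord m.+1 by apply: val_inj; rewrite /= inordK.
  have -> : widen_ord (leqnSn n) (Ordinal mn) = inord m.
    by apply: val_inj; rewrite /= inordK // ltnS ltnW.
  move=> ->; rewrite IH 1?ltnW // [RHS](bigD1 (Ordinal mn)) //= addnC; congr addn.
  by apply: eq_bigl => i; rewrite ltnS ltn_neqAle andbC.
have := part n (leqnn n); have -> : inord n = ord_max :> 'I_n.+1.
  by apply: val_inj; rewrite /= inordK.
have iso : isomorphic (sub_obj (c ord_max)) X by exists (sub_map (c ord_max)).
rewrite -(additive_iso add (sub_obj_E _) iso) => ->.
by apply: eq_bigl => i; rewrite ltn_ord.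
Qed.

End Series.
End CompositionSeries.

(** * From filtrations to composition series *)

Section SeriesOfFiltration.
Variables (n : nat) (S : 'I_n -> lmodType A).

Definition series_with X (v : 'I_n -> nat) : Prop :=
  exists m (c : 'I_m.+1 -> admissible_subobject E X) (Q : 'I_m -> lmodType A),
    [/\ composition_series c, forall i, composition_factor c i (Q i)
      & forall k, v k = (\sum_i cls S (Q i) k)%N].

Lemma series_zero X v : zero_module X -> (forall k, v k = 0%N) -> series_with X v.
Proof.
move=> X0 v0; have EX := E_zero X0.
have [B BE] := admissible_of_inj (f := idfun) EX EX (@inj_id X).
exists 0%N, (fun _ => B), (fun _ => X); split=> [|[]//|k]; last by rewrite big_ord0.
split=> [x||[[|i] hi] [[|j] hj] //|C _].
- by apply: (@sub_map_inj _ B); rewrite [LHS]X0 [RHS]X0.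
- apply: inj_surj_bij; first exact: sub_map_inj.
  by move=> x; apply/BE; exists x.
exists ord0; split; apply/sub_leP => x; last by exists 0; rewrite [LHS]X0 [RHS]X0.
by exists 0; rewrite [LHS]X0 [RHS]X0.
Qed.

(** A maximal chain of [Y] stays maximal in [X] after adding [X] on top. A subobject comparable to
    the whole chain lies in [Y], where maximality is known, or contains [Y], where simplicity of [Q]
    decides. *)
Lemma series_step X Y Q (f : {linear Y -> X}) (g : {linear X -> Q}) v w :
  short_exact f g -> series_with Y v -> E Y -> simple_object E Q ->
  (forall k, w k = (v k + cls S Q k)%N) -> series_with X w.
Proof.
move=> ex [m [c [P [cs fP vE]]]] EY sQ wE.
have /simple_objectP [EQ nQ Qmin] := sQ.
have EX := E_ext ex EY EQ; have [fi gs gE] := ex; have [c0 top lt cmax] := cs.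
have push_inf (B : admissible_subobject E Y) : inflation E (f \o sub_map B).
  apply/inflationP; split=> //; first exact: sub_obj_E.
  exact: inj_comp fi (@sub_map_inj _ B).
pose push B := AdmissibleSubobject (push_inf B).
have topX_inf : inflation E (idfun : {linear X -> X}).
  by apply/inflationP; split=> //; apply: inj_id.
pose topX := AdmissibleSubobject topX_inf.
pose d (i : 'I_m.+2) := if (i < m.+1)%N then push (c (inord i)) else topX.
have push_le B C : sub_le B C <-> sub_le (push B) (push C).
  rewrite !sub_leP; split=> h x; have [y e] := h x; exists y; last exact: fi.
  by rewrite /= e.
have le_topX (B : admissible_subobject E X) : sub_le B topX.
  by apply/sub_leP => x; exists (sub_map B x).
have not_topX B : ~ sub_le topX (push B).
  move/sub_leP => h; apply: nQ => q; have [x <-] := gs q; apply/gE.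
  by have [y /= e] := h x; exists (sub_map B y).
have rangeY x : (exists y, sub_map (push (c ord_max)) y = x) <-> exists y, f y = x.
  split=> [[y <-]|[y <-]]; first by exists (sub_map (c ord_max) y).
  by have [z <-] := bij_surj top y; exists z.
(* The new factor [Q] sits at index [m]; the reflected test supplies the bound needed to form an
   index of [P]. *)
exists m.+1, d, (fun i => if (i < m)%N =P true is ReflectT h then P (Ordinal h) else Q).
split.
- split.
  + rewrite /d /=; have -> : inord 0 = ord0 :> 'I_m.+1 by apply: val_inj; rewrite /= inordK.
    exact: c0.
  + by rewrite /d /= ltnn; exists idfun.
  + move=> i j ij; rewrite /d; case: ltnP => im; case: ltnP => jm.
    * have [le nle] := lt (inord i) (inord j) ltac:(by rewrite !inordK).
      by split=> [|/push_le]; first exact/push_le.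
    * by split=> //; apply: not_topX.
    * by have := leq_trans im (ltnW ij); rewrite leqNgt jm.
    * by have := leq_ltn_trans im ij; rewrite ltnNge -ltnS ltn_ord.
  + move=> B cB; have dmax : d (inord m) = push (c ord_max).
      rewrite /d inordK // ltnSn; congr (push (c _)); apply: val_inj => /=.
      by rewrite inordK.
    have small (C : admissible_subobject E Y) : sub_eq B (push C) -> exists i, sub_eq B (d i).
      move=> [BC CB]; case: (cmax C) => [i|i [Ci iC]].
        have := cB (inord i); rewrite /d inordK ?ltn_ord; last exact: ltnW (ltn_ord _).
        rewrite inord_val; case=> h; [left|right]; apply/push_le.
          exact: sub_le_trans CB h.
        exact: sub_le_trans h BC.
      exists (inord i); rewrite /d inordK ?ltn_ord; last exact: ltnW (ltn_ord _).
      rewrite inord_val; split; first by apply: sub_le_trans BC _; apply/push_le.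
      by apply: sub_le_trans CB; apply/push_le.
    (* Member [m] is the image of [Y], and [B] is comparable to it. *)
    case: (cB (inord m)); rewrite dmax => /sub_leP h.
      have hB x : exists y, f y = sub_map B x by apply/rangeY.
      have [t tE] := factor_inj fi hB.
      have [|C CE] := admissible_of_inj (f := t) (@sub_obj_E _ B) EY.
        by move=> x y e; apply: (@sub_map_inj _ B); rewrite -!tE e.
      apply: (small C); split; apply/sub_leP => x.
        have [y e] := (CE (t x)).2 (ex_intro _ x erefl).
        by exists y; rewrite /= e tE.
      by have [y e] := (CE _).1 (ex_intro _ x erefl); exists y; rewrite -tE /= e.
    (* The image of [B] in [Q] is a quotient of an object of [E], so it is zero or all of [Q];
       accordingly [B] is the image of [Y] or [X]. *)
    have [V [j [ji jE]]] := sub_existsP (submod_range (g \o sub_map B)).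
    have [u uE] : {u : {linear sub_obj B -> V} | forall x, j (u x) = g (sub_map B x)}.
      by apply: (@factor_inj A _ _ _ j (g \o sub_map B)) => // x; apply/jE; exists x.
    have EV : E V.
      apply: (Equot (p := u)) (@sub_obj_E _ B) => y.
      have [x /= e] := (jE (j y)).2 (ex_intro _ y erefl).
      by exists x; apply: ji; rewrite uE.
    have BY x : (exists y, f y = x) -> exists b, sub_map B b = x.
      by case/rangeY => y <-; have [b <-] := h y; exists b.
    case: (Qmin _ j EV ji) => [V0|js].
      apply: (small (c ord_max)); split; apply/sub_leP => // x.
      by apply/rangeY/gE; rewrite -uE (V0 (u x)) linear0.
    exists ord_max; rewrite /d /= ltnn; split=> //; apply/sub_leP => x /=.
    have [b' /= eb] : exists b, (g \o sub_map B) b = g x.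
      by apply/jE; have [z zE] := js (g x); exists z.
    have [|b2 b2E] := BY (x - sub_map B b').
      by apply/gE; rewrite linearB eb subrr.
    by exists (b' + b2); rewrite linearD b2E addrC subrK.
- move=> i; rewrite /composition_factor /d /=.
  case: eqP => im; last first.
    have {}im : i = m :> nat by apply/eqP; rewrite eqn_leq -ltnS ltn_ord leqNgt; apply/negP.
    rewrite im ltnSn /bump add1n ltnn.
    have -> : inord m = ord_max :> 'I_m.+1 by apply: val_inj; rewrite /= inordK.
    exists (f \o sub_map (c ord_max)), g; split=> //; split=> //.
      exact: sub_obj_E.
    split=> //; first by apply: inj_comp fi (@sub_map_inj _ _).
    by move=> x; rewrite gE -rangeY.
  rewrite ltn_ord /bump add1n ltnS im.
  have [h [k [hE cf]]] := fP (Ordinal im).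
  have e1 : widen_ord (leqnSn m) (Ordinal im) = inord i.
    by apply: val_inj; rewrite /= inordK // ltnW.
  have e2 : lift ord0 (Ordinal im) = inord i.+1 by apply: val_inj; rewrite /= inordK.
  rewrite e1 e2 in h k hE cf *.
  by exists h, k; split=> // x /=; rewrite hE.
- move=> k; rewrite wE vE big_ord_recr /=; congr addn; last first.
    by case: eqP => // p; exfalso; move: (p); rewrite ltnn.
  apply: eq_bigr => i _; case: eqP => //= [h|[]]; last by rewrite ltn_ord.
  by congr cls; congr P; apply: val_inj.
Qed.

Lemma comp_series X v : comp S X v -> series_with X v.
Proof.
elim=> [{}X {}v|{}X Y Q f g {}v w ex cY IH sQ wE]; first exact: series_zero.
exact: series_step ex IH (comp_E cY) sQ wE.
Qed.

Lemma JHP_comp_unique X v w : JHP E -> comp S X v -> comp S X w -> v = w.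
Proof.
move=> jhp cv cw; have EX := comp_E cv.
have [m [c [P [cs fP vE]]]] := comp_series cv.
have [m' [d [Q [ds fQ wE]]]] := comp_series cw.
have [e [sigma [bs sP]]] := jhp _ EX _ _ _ _ cs ds.
apply/funext => k; rewrite vE wE (reindex sigma) /=; last exact: onW_bij.
apply: eq_bigr => i _; apply: cls_iso.
have [U [U' [hU hU' iso]]] := sP i.
apply: iso_trans (sub_quotient_iso (fP i) hU) _.
exact: iso_trans iso (sub_quotient_iso hU' (fQ _)).
Qed.

(** Uniqueness makes multiplicities functions of the object, and concatenating filtrations makes
    them additive. *)
Lemma JHP_multiplicity : JHP E -> exists phi : 'I_n -> lmodType A -> nat,
  (forall k, additive_on (phi k)) /\
  forall X k, simple_object E X -> phi k X = cls S X k.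
Proof.
move=> jhp.
have ex X : exists v : 'I_n -> nat, E X -> comp S X v.
  have [EX|nEX] := EM (E X); last by exists (fun=> 0%N) => /nEX.
  by have [v cv] := comp_exists S EX; exists v.
have [phi phiP] := choice ex.
exists (fun k X => phi X k); split=> [k X Y Z f g EX EZ fg|X k sX].
  have c1 := comp_ext fg (phiP _ EX) (phiP _ EZ).
  by rewrite (JHP_comp_unique jhp (phiP _ (comp_E c1)) c1).
have EX : E X by case: sX.
have [Z [i [ii iE]]] := sub_existsP (submod0 X).
have Z0 : zero_module Z.
  by move=> z; apply: ii; rewrite linear0; apply/iE; exists z.
have cX : comp S X (cls S X).
  apply: (@comp_step _ _ X Z X i idfun (fun=> 0%N)) sX _ => //; last exact: comp_zero.
  by split=> // y; exists y.
by rewrite (JHP_comp_unique jhp (phiP _ EX) cX).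
Qed.

End SeriesOfFiltration.
(* Both sides are phi of the pushout of i and i'. *)
Lemma additive_pushout phi Z X X' Q Q' (i : {linear Z -> X}) (p : {linear X -> Q})
  (i' : {linear Z -> X'}) (p' : {linear X' -> Q'}) : additive_on phi -> E X -> E X' ->
  short_exact i p -> short_exact i' p' -> (phi X + phi Q' = phi X' + phi Q)%N.
Proof.
move=> add EX EX' ex ex'; have [ii ps pE] := ex; have [ii' ps' pE'] := ex'.
have [||d dE] := @linear_ofP A Z (X * X')%type (fun z => (i z, - i' z)).
- by move=> x y; rewrite !linearD.
- by move=> a x; congr pair; rewrite linearZ // scalerN.
have [P [q [qs qE]]] := quot_existsP (submod_range d).
(* Only the pushout has to lie in [E]; the common submodule [Z] may be outside. *)
have EP : E P := Equot qs (E_prod EX EX').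
have [||f fE] := @linear_ofP A X P (fun x => q (x, 0)).
- by move=> x y; rewrite -linearD; congr (q (_, _)); rewrite addr0.
- by move=> a x; rewrite -linearZ; congr (q (_, _)); rewrite scaler0.
have [||f' f'E] := @linear_ofP A X' P (fun x => q (0, x)).
- by move=> x y; rewrite -linearD; congr (q (_, _)); rewrite addr0.
- by move=> a x; rewrite -linearZ; congr (q (_, _)); rewrite scaler0.
have [||g0 g0E] := @linear_ofP A (X * X')%type Q' (fun u => p' u.2).
- by move=> x y; rewrite linearD.
- by move=> a x; rewrite linearZ.
have [||g0' g0'E] := @linear_ofP A (X * X')%type Q (fun u => p u.1).
- by move=> x y; rewrite linearD.
- by move=> a x; rewrite linearZ.
have [g gE] : {g : {linear P -> Q'} | forall u, g (q u) = g0 u}.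
  apply: factor_surj => // u /qE [z <-]; rewrite g0E dE linearN.
  by apply/eqP; rewrite oppr_eq0; apply/eqP/pE'; exists z.
have [g' g'E] : {g : {linear P -> Q} | forall u, g (q u) = g0' u}.
  by apply: factor_surj => // u /qE [z <-]; rewrite g0'E dE; apply/pE; exists z.
have e1 : short_exact f g.
  split.
  - apply: linear_inj0 => x; rewrite fE => /qE [z]; rewrite dE => -[<- /eqP].
    by rewrite oppr_eq0 => /eqP e; rewrite (ii' z 0) ?linear0.
  - by move=> y; have [x' <-] := ps' y; exists (q (0, x')); rewrite gE g0E.
  - move=> y; have [[x x'] <-] := qs y; rewrite gE g0E /=; split=> [/pE' [z <-]|[t]].
      exists (x + i z); rewrite fE; apply/eqP; rewrite -subr_eq0 -linearB; apply/eqP/qE.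
      by exists z; rewrite dE; congr pair; rewrite ?sub0r //= addrAC subrr add0r.
    rewrite fE => /eqP; rewrite -subr_eq0 -linearB => /eqP /qE [z].
    rewrite dE => -[_]; rewrite sub0r => /oppr_inj <-.
    by apply/pE'; exists z.
have e2 : short_exact f' g'.
  split.
  - apply: linear_inj0 => x; rewrite f'E => /qE [z]; rewrite dE => -[iz <-].
    by rewrite (ii z 0) ?linear0 ?oppr0.
  - by move=> y; have [x <-] := ps y; exists (q (x, 0)); rewrite g'E g0'E.
  - move=> y; have [[x x'] <-] := qs y; rewrite g'E g0'E /=; split=> [/pE [z <-]|[t]].
      exists (x' + i' z); rewrite f'E; apply/eqP; rewrite -subr_eq0 -linearB; apply/eqP/qE.
      exists (- z); rewrite dE !linearN opprK; congr pair; rewrite ?sub0r //=.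
      by rewrite addrAC subrr add0r.
    rewrite f'E => /eqP; rewrite -subr_eq0 -linearB => /eqP /qE [z].
    rewrite dE => -[+ _]; rewrite sub0r => e.
    by apply/pE; exists (- z); rewrite linearN e opprK.
have EQ := Equot ps EX; have EQ' := Equot ps' EX'.
by rewrite -(add _ _ _ _ _ EX EQ' e1) -(add _ _ _ _ _ EX' EQ e2).
Qed.

(** Simplicity among all modules, in contrast to [simple_object]; simple submodules of objects of
    [E] may lie outside [E]. *)
Definition simple_module M : Prop := ~ zero_module M /\
  forall W : M -> Prop, submod W -> (forall x, W x -> x = 0) \/ (forall x, W x).

(** * Bounding the number of independent additive functions *)

Section RankBound.
Variables (r : nat) (K : lmodType A -> 'I_r -> Prop).
Hypothesis K_ex : forall Z X (i : {linear Z -> X}),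
  simple_module Z -> E X -> injective i -> exists a, K Z a.
Hypothesis K_iso : forall Z Z' a, simple_module Z -> simple_module Z' ->
  K Z a -> K Z' a -> isomorphic Z Z'.

(** [K] attaches one of [r] labels to each simple module that occurs, separating isomorphism
    classes. [u a k] is the drop of [phi k] on dividing by a simple submodule labelled [a], possibly
    negative, and [c a] counts such divisions. *)
Lemma additive_span (I : Type) (phi : I -> lmodType A -> nat) :
  (forall k, additive_on (phi k)) ->
  exists u : 'I_r -> I -> rat, forall X, E X -> exists c : 'I_r -> rat,
    forall k, (phi k X)%:R = \sum_a c a * u a k.
Proof.
move=> add.
have ex a : exists u : I -> rat, forall Z X Q (i : {linear Z -> X}) (p : {linear X -> Q}),
    simple_module Z -> K Z a -> E X -> short_exact i p ->
    forall k, (phi k X)%:R = (phi k Q)%:R + u k.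
  have [[Z0 [X0 [Q0 [i0 [p0 [sZ0 KZ0 EX0 ex0]]]]]]|no] := EM (exists Z0 X0 Q0
      (i0 : {linear Z0 -> X0}) (p0 : {linear X0 -> Q0}),
      [/\ simple_module Z0, K Z0 a, E X0 & short_exact i0 p0]); last first.
    (* A label that no simple submodule of an object of [E] carries gets the drop 0. *)
    exists (fun=> 0) => Z X Q i p sZ KZ EX ex.
    by case: no; exists Z, X, Q, i, p.
  exists (fun k => (phi k X0)%:R - (phi k Q0)%:R) => Z X Q i p sZ KZ EX ex k.
  have [h bh] := K_iso sZ0 sZ KZ0 KZ.
  have ex' : short_exact (i \o h) p.
    case: ex => ii ps pE; split=> // [|x]; first exact: inj_comp ii (bij_inj bh).
    rewrite pE; split=> [[z <-]|[z <-]]; last by exists (h z).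
    by have [z' <-] := bij_surj bh z; exists z'.
  have := additive_pushout (add k) EX0 EX ex0 ex'.
  move/(congr1 (fun m : nat => m%:R : rat)); rewrite !natrD => e.
  by rewrite addrA [_%:R + _%:R]addrC e addrK.
have [u uP] := choice ex; exists u.
move=> X; move: {2}(mlen X).+1 (ltnSn (mlen X)) => m; elim: m X => // m IH X; rewrite ltnS => le EX.
have [X0|nX] := EM (zero_module X).
  by exists (fun=> 0) => k; rewrite (additive_zero (add k) X0) big1 // => a _; rewrite mul0r.
have [W [sW [x0 Wx0 x00] Wmin]] := fl_simple_sub (E_fl EX) nX.
have [Z [i [ii iE]]] := sub_existsP sW; have [Q [p exQ]] := short_exact_quot ii.
have nZ : ~ zero_module Z.
  by move=> Z0; apply: x00; have [z <-] := (iE _).1 Wx0; rewrite (Z0 z) linear0.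
have sZ : simple_module Z.
  split=> // V sV; have [|h|h] := Wmin _ (submod_img i sV).
  - by move=> _ [z _ <-]; apply/iE; exists z.
  - by left=> z Vz; apply: ii; rewrite linear0; apply: h; exists z.
  - right=> z; have [|z' Vz' /ii <-//] := h (i z).
    by apply/iE; exists z.
have [_ ps _] := exQ; have EQ := Equot ps EX.
have [|c cP] := IH Q _ EQ.
  apply: leq_trans le; rewrite (mlen_short_exact (fl_inj ii (E_fl EX)) (E_fl EX) exQ).
  rewrite -[X in (X < _)%N]add0n ltn_add2r lt0n; apply/eqP.
  by move/(mlen_eq0 (fl_inj ii (E_fl EX))).
have [a Ka] := K_ex sZ EX ii.
exists (fun b => c b + (b == a)%:R) => k; rewrite (uP a _ _ _ _ _ sZ Ka EX exQ) cP.
under [RHS]eq_bigr do rewrite mulrDl; rewrite big_split; congr (_ + _).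
by rewrite (bigD1 a) //= eqxx mul1r big1 ?addr0 // => b /negbTE ->; rewrite mul0r.
Qed.

(** The values of the functions on the [S l] form an identity matrix of size [n] that factors
    through dimension [r]. *)
Lemma additive_rank_bound n (S : 'I_n -> lmodType A) (phi : 'I_n -> lmodType A -> nat) :
  (forall k, additive_on (phi k)) -> (forall k, E (S k)) ->
  (forall k l, phi k (S l) = (k == l) :> nat) -> (n <= r)%N.
Proof.
move=> add ES dual; have [u uP] := additive_span add.
have [c cP] := choice (fun l => uP _ (ES l)).
have e : 1%:M = (\matrix_(l, a) c l a) *m (\matrix_(a, k) u a k) :> 'M[rat]_n.
  apply/matrixP => l k; rewrite !mxE eq_sym -dual cP.
  by apply: eq_bigr => a _; rewrite !mxE.
by rewrite -(mxrank1 rat n) e mulmx_max_rank.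
Qed.

End RankBound.

(** * Independence of the Hom-length functions on simple objects *)

Section DualRank.
Variables (n N : nat) (S : 'I_N -> lmodType A).
Hypothesis S_inj : forall i j, isomorphic (S i) (S j) -> i = j.
Hypothesis S_all : forall Q, simple_object E Q -> exists k, isomorphic Q (S k).
Variables (phi : 'I_n -> lmodType A -> nat) (T : 'I_n -> lmodType A).
Hypothesis phi_add : forall j, additive_on (phi j).
Hypothesis ET : forall i, E (T i).
Hypothesis dual : forall i, exists X Y, [/\ E X, E Y,
  forall j, i <> j -> (phi j (T i) + phi j Y = phi j X)%N
  & (phi i X < phi i (T i) + phi i Y)%N].

Let H : 'M[rat]_(n, N) := \matrix_(j, k) (phi j (S k))%:R.

Let expand X : E X -> exists v : 'I_N -> rat, forall j, (phi j X)%:R = \sum_k (phi j (S k))%:R * v k.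
Proof.
move=> EX; have [v cv] := comp_exists S EX; exists (fun k => (v k)%:R) => j.
rewrite (comp_additive (phi_add j) S_inj S_all cv) natr_sum.
by apply: eq_bigr => k _; rewrite natrM mulrC.
Qed.

(** Expanding [T i] + [Y] - [X] in simple objects gives a vector that [H] sends to a nonzero
    multiple of the [i]-th basis vector. So [H] times some matrix is diagonal and invertible, and
    [H] has full row rank. *)
Let H_free : row_free H.
Proof.
have ex i : exists w : 'I_N -> rat, exists2 d : rat, d != 0 &
    forall j, \sum_k (phi j (S k))%:R * w k = d *+ (j == i).
  have [X [Y [EX EY off diag]]] := dual i.
  have [t tE] := expand (ET i); have [x xE] := expand EX; have [y yE] := expand EY.
  exists (fun k => t k + y k - x k), ((phi i (T i) + phi i Y)%:R - (phi i X)%:R).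
    by rewrite subr_eq0 eqr_nat gtn_eqF.
  move=> j; under eq_bigr do rewrite mulrBr mulrDr.
  rewrite sumrB big_split /= -tE -yE -xE -natrD.
  by case: eqP => [->//|/eqP]; rewrite eq_sym => /eqP /off ->; rewrite subrr.
have [w wP] := choice ex.
have [d dP] : exists d : 'I_n -> rat, forall i, d i != 0 /\
    forall j, \sum_k (phi j (S k))%:R * w i k = d i *+ (j == i).
  have [d dP] := choice (fun i => let: ex_intro2 d d0 h := wP i in ex_intro
    (fun d => d != 0 /\ forall j, \sum_k (phi j (S k))%:R * w i k = d *+ (j == i)) d (conj d0 h)).
  by exists d.
have e : H *m (\matrix_(k, i) w i k) = diag_mx (\row_i d i).
  apply/matrixP => j i; rewrite !mxE.
  under eq_bigr do rewrite !mxE.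
  by rewrite (dP i).2; case: eqP => [->|].
rewrite /row_free eqn_leq rank_leq_row /=.
suff rk : \rank (H *m (\matrix_(k, i) w i k)) = n.
  by move: (mxrankM_maxl H (\matrix_(k, i) w i k)); rewrite rk.
rewrite e mxrank_unit // unitmxE det_diag unitfE; apply/prodf_neq0 => i _.
by rewrite mxE; case: (dP i).
Qed.

Lemma dual_rank : (n <= N)%N.
Proof. by have /eqP <- := H_free; apply: rank_leq_col. Qed.

(** For n = N the matrix [H] is square, hence injective on multiplicity vectors. *)
Lemma dual_cancel (a b : 'I_N -> nat) : n = N ->
  (forall j, (\sum_k a k * phi j (S k) = \sum_k b k * phi j (S k))%N) -> forall k, a k = b k.
Proof.
move=> eN h k; have full : row_full H by rewrite /row_full (eqP H_free); apply/eqP.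
have /(row_full_inj full)/colP/(_ k) : H *m (\col_k (a k)%:R) = H *m (\col_k (b k)%:R).
  apply/colP => j; rewrite !mxE.
  under eq_bigr do rewrite !mxE -natrM mulnC.
  under [RHS]eq_bigr do rewrite !mxE -natrM mulnC.
  by rewrite -!natr_sum h.
by rewrite !mxE => /eqP; rewrite eqr_nat => /eqP.
Qed.

Lemma JHP_of_dual : n = N -> JHP E.
Proof.
move=> eN X EX l c m d cs ds.
(* Each factor is labelled by its isomorphism class, so that multiplicities become cardinalities of
   fibres of [kc]. *)
have fam l' (c' : 'I_l'.+1 -> admissible_subobject E X) : composition_series c' ->
    exists (Q : 'I_l' -> lmodType A) (kc : 'I_l' -> 'I_N), [/\ forall i, composition_factor c' i (Q i),
      forall i, isomorphic (Q i) (S (kc i))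
    & forall j, phi j X = (\sum_k #|[pred i | kc i == k]| * phi j (S k))%N].
  move=> cs'.
  have [Q QP] := choice (fun i => series_factor cs' i).
  have [kc kcP] := choice (fun i => S_all (let: And3 _ s _ := QP i in s)).
  exists Q, kc; split=> // [i|j]; first by case: (QP i).
  rewrite (series_additive cs' (phi_add j) (Q := Q)); last by move=> i; case: (QP i).
  rewrite (partition_big kc xpredT) //=; apply: eq_bigr => k _.
  rewrite -sum_nat_const; apply: eq_bigr => i /eqP <-.
  by apply: (additive_iso (phi_add j)) => //; case: (QP i) => _ [].
have [Q [kc [fQ isoQ sumQ]]] := fam _ _ cs.
have [P [kd [fP isoP sumP]]] := fam _ _ ds.
have cnt k : #|[pred i | kc i == k]| = #|[pred i | kd i == k]|.
  by apply: (dual_cancel (a := fun k => #|[pred i | kc i == k]|)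
    (b := fun k => #|[pred i | kd i == k]|)) => // j; rewrite -sumQ -sumP.
have total l' (f : 'I_l' -> 'I_N) : l' = (\sum_k #|[pred i | f i == k]|)%N.
  rewrite -[LHS]card_ord -sum1_card (partition_big f xpredT) //=.
  by apply: eq_bigr => k _; rewrite -sum1_card.
have em : m = l.
  by rewrite (total _ kc) (total _ kd); apply: eq_bigr => k _; rewrite cnt.
subst m; split=> //.
(* Labellings with fibres of equal size differ by a permutation of the indices, which serves as
   [sigma]. *)
have pe : perm_eq [tuple kc i | i < l] [tuple kd i | i < l].
  apply/allP => k _ /=; apply/eqP; rewrite !count_map.
  by have := cnt k; rewrite !cardE /enum_mem !size_filter -enumT.
have /tuple_permP [s sE] := pe.
exists s; split; first exact/injF_bij/perm_inj.
move=> i; exists (Q i), (P (s i)); split=> //.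
have ki : kc i = kd (s i).
  have := congr1 (fun t => nth (kc i) t i) sE.
  by rewrite -!(tnth_nth (kc i)) !tnth_mktuple.
by apply: iso_trans (isoQ i) _; rewrite ki; apply: iso_sym.
Qed.

End DualRank.

(** A largest pairwise non-isomorphic family represents every class, since a missing module could be
    adjoined. *)
Lemma num_iso_classes_bounded (P : lmodType A -> Prop) r :
  (forall n (S : 'I_n -> lmodType A), (forall k, P (S k)) ->
    (forall i j, isomorphic (S i) (S j) -> i = j) -> (n <= r)%N) ->
  exists2 n, num_iso_classes P n & (n <= r)%N.
Proof.
move=> bound.
pose fam n (S : 'I_n -> lmodType A) := (forall k, P (S k)) /\
  forall i j, isomorphic (S i) (S j) -> i = j.
have ex : exists n, `[< exists S : 'I_n -> lmodType A, fam n S >].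
  by exists 0%N; apply/asboolP; exists (fun _ => A^o); split=> -[].
have bd n : `[< exists S : 'I_n -> lmodType A, fam n S >] -> (n <= r)%N.
  by case/asboolP => S [PS inj]; apply: bound PS inj.
have [n /asboolP [S [PS inj]] nmax] := ex_maxnP ex bd.
exists n; last by apply: bound PS inj.
exists S; split=> // M PM; apply: contrapT => nM.
suff /nmax : `[< exists S : 'I_n.+1 -> lmodType A, fam n.+1 S >] by rewrite ltnn.
apply/asboolP; exists (fun i => if unlift ord0 i is Some j then S j else M); split.
  by move=> k; case: unliftP.
move=> i j; case: unliftP => [i' ->|->]; case: unliftP => [j' ->|-> //].
- by move/inj ->.
- by move=> iso; case: nM; exists i'; apply: iso_sym.
- by move=> iso; case: nM; exists j'.
Qed.
End TorsionClass.

(** * Tau-rigid modules are Ext-projective *)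

Section Cogenerator.
Variable R : comPzRingType.
Hypothesis artR : artinian R.
Implicit Types I m : R -> Prop.

Lemma fl_regular : fl idfun (R^o : lmodType R).
Proof.
have [||f fE] := @linear_ofP R R^o (Res idfun (R^o : lmodType R)) id => //.
apply: fin_len_sub (@fin_len_img _ _ _ f _ (submodT _) (artinian_fin_len artR)) => x _.
by exists x.
Qed.

Lemma exists_maximal_ideal I : ideal I -> ~ I 1 ->
  exists m, maximal_ideal m /\ forall x, I x -> m x.
Proof.
move=> iI I1.
have sI : submod (I : R^o -> Prop) by case: iI.
have [|m [sm [m1 Im] mmax]] := @fl_max _ _ _ (R^o : lmodType R)
  (fun W => ~ W 1 /\ forall x : R, I x -> W x) _ fl_regular sI; first by [].
exists m; split=> //; split=> // K iK mK; have [K1|nK1] := EM (K 1); first by right.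
by left; apply: mmax => //; split=> // x /Im /mK.
Qed.

Lemma maximal_ideal_prime m x y : maximal_ideal m -> ~ m x -> ~ m y -> ~ m (x * y).
Proof.
move=> [[m0 mD mZ] m1 mmax] mx my mxy.
have [||h|[r [a [ma e]]]] := mmax (fun z => exists r a, m a /\ z = r * x + a).
- split; first by exists 0, 0; rewrite mul0r addr0.
    move=> _ _ [r [a [ma ->]]] [s [b [mb ->]]]; exists (r + s), (a + b).
    by split; [apply: mD|rewrite mulrDl addrACA].
  move=> t _ [r [a [ma ->]]]; exists (t * r), (t * a).
  by split; [apply: mZ|rewrite mulrDr mulrA].
- by move=> z mz; exists 0, z; rewrite mul0r add0r.
- by apply/mx/h; exists 1, 0; rewrite mul1r addr0.
- by apply: my; rewrite -(mul1r y) e mulrDl -mulrA [a * y]mulrC; apply: mD; apply: mZ.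
Qed.

(* The class of s spans a copy of R / m inside R / rad R. *)
Lemma maximal_ideal_socle m : maximal_ideal m ->
  exists s, ~ radical s /\ forall x, m x -> radical (x * s).
Proof.
move=> mm; have [im m1 mmax] := mm.
have iR : ideal (fun _ : R => True) by [].
(* [K] is minimal among ideals not contained in [m]. For another maximal ideal [I], primality keeps
   the intersection of [K] and [I] outside [m], so [K] lies in [I]; thus [s] is in every maximal
   ideal except [m]. *)
have [|K [iK [s Ks ms] Kmin]] := artinian_min artR (P := fun I => exists2 x, I x & ~ m x) iR.
  by exists 1.
exists s; split=> [/(_ _ mm)//|x mx I mI]; have [[I0 ID IZ] I1 Imax] := mI.
have [sub|nsub] := EM (forall y, I y -> m y).
  have [mI'|//] := Imax m im sub.
  by rewrite mulrC; apply/IZ/mI'.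
have [b Ib mb] : exists2 b, I b & ~ m b.
  by apply: contrapT => h; apply: nsub => y Iy; apply: contrapT => my; apply: h; exists y.
have [K0 KD KZ] := iK.
suff [] : K s /\ I s by move=> _ Is; apply: IZ.
apply: (Kmin (fun y => K y /\ I y)) => //; last by move=> y [].
- split=> // [y z [? ?] [? ?]|a y [? ?]]; split; first exact: KD.
  + exact: ID.
  + exact: KZ.
  + exact: IZ.
- exists (b * s); last by apply: maximal_ideal_prime.
  by split; [apply: KZ|rewrite mulrC; apply: IZ].
Qed.

(** The annihilator of [z] lies in a maximal ideal [m], so R z maps onto R/m, which embeds into
    R/rad R and thus into [J]. Injectivity of [J] extends the map to [Z]. *)
Lemma dualizing_cogenerator (J Z : lmodType R) (z : Z) : dualizing_module J -> z <> 0 ->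
  exists l : {linear Z -> J}, l z <> 0.
Proof.
move=> [S [p [i [ps pE [Jinj ii _]]]]] z0.
have [||m [mm mz]] := @exists_maximal_ideal (fun r => r *: z = 0).
- split=> [|x y hx hy|a x hx]; first by rewrite scale0r.
    by rewrite scalerDl hx hy addr0.
  by rewrite -scalerA hx scaler0.
- by rewrite scale1r.
have [s [nrs hs]] := maximal_ideal_socle mm.
have [f fE] := scale_linearP z.
have [U [j [ji jE]]] := sub_existsP (submod_range f).
have [f' f'E] : {f' : {linear R^o -> U} | forall r, j (f' r) = f r}.
  by apply: factor_inj => // r; apply/jE; exists r.
have [k kE] := scale_linearP (i (p s)).
have [|r f'r|g gE] := @factor_surj R _ _ _ f' k.
- by move=> u; have [r e] := (jE (j u)).2 (ex_intro _ u erefl); exists r; apply: ji; rewrite f'E.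
- have pr : p ((r : R) *: (s : R^o)) = 0.
    apply/pE; apply: (hs (r : R)); apply: mz; apply: etrans (esym (fE r)) _.
    by rewrite -f'E f'r linear0.
  by rewrite kE -[X in i X]/(p (s : R^o)) -!linearZ pr linear0.
have [l lE] := Jinj _ _ j g ji; exists l.
have -> : z = j (f' 1) by rewrite f'E fE scale1r.
rewrite lE gE kE scale1r => /eqP; rewrite -(linear0 i) => /eqP /ii /pE.
exact: nrs.
Qed.

End Cogenerator.

(** * Vanishing of maps into tau M and lifting of maps from M *)

Section TauRigid.
Variables (R : comPzRingType) (G : pzRingType) (iota : {rmorphism R -> G}).
Hypothesis artR : artinian R.
Hypothesis cen : forall r a, iota r * a = a * iota r.

Lemma converse_rmorphism : {io : {rmorphism R -> G^c} |
  forall r, io r = iota r :> G & forall r a, io r * a = a * io r}.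
Proof.
have m1 : monoid_morphism (iota : R -> G^c).
  split=> [|x y]; first exact: (rmorph1 iota).
  by apply: etrans (rmorphM iota x y) _; apply: cen.
pose io : {rmorphism R -> G^c} := HB.pack (iota : R -> G^c)
  (GRing.isZmodMorphism.Build R G^c iota (rmorphB iota))
  (GRing.isMonoidMorphism.Build R G^c (iota : R -> G^c) m1).
by exists io => // r a; apply: esym (cen r a).
Qed.

Lemma additive_ofP (U V : zmodType) (f : U -> V) : (forall x y, f (x + y) = f x + f y) ->
  {g : {additive U -> V} | forall x, g x = f x}.
Proof.
move=> fD.
have f0 : f 0 = 0 by apply: (addrI (f 0)); rewrite -fD !addr0.
have fB : zmod_morphism f.
  move=> x y; apply: (addIr (f y)); rewrite -fD subrK -addrA addNr addr0 //.
pose g : {additive U -> V} := HB.pack f (GRing.isZmodMorphism.Build U V f fB).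
by exists g.
Qed.

(** The [phi j] are the coordinates of a section of the surjection from the free module onto [P]. *)
Lemma projective_dual_basis (A : pzRingType) (P : lmodType A) k (p : 'I_k -> P) :
  projective P -> (forall x, exists a : 'I_k -> A, x = \sum_j a j *: p j) ->
  exists phi : 'I_k -> {linear P -> A^o}, forall x, x = \sum_j (phi j x : A) *: p j.
Proof.
move=> Pproj gen.
have [||q qE] := @linear_ofP A {ffun 'I_k -> A^o} P (fun u => \sum_j (u j : A) *: p j).
- by move=> u v; rewrite -big_split; apply: eq_bigr => j _; rewrite ffunE scalerDl.
- by move=> a u; rewrite scaler_sumr; apply: eq_bigr => j _; rewrite ffunE scalerA.
have [x|s sE] := Pproj _ _ q idfun.
  by have [a ->] := gen x; exists [ffun j => a j]; rewrite qE; apply: eq_bigr => j _; rewrite ffunE.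
have ex j : exists f : {linear P -> A^o}, forall x, f x = s x j.
  have [||f fE] := @linear_ofP A P A^o (fun x => s x j); last by exists f.
    by move=> x y; rewrite linearD ffunE.
  by move=> a x; rewrite linearZ ffunE.
have [phi phiE] := choice ex; exists phi => x.
by apply: etrans (esym (sE x)) _; rewrite qE; apply: eq_bigr => j _; rewrite phiE.
Qed.

(* A map P1 -> Y that does not factor through P0 is detected by a functional
   l : Hom(P1, Y) -> J killing the maps that do; pairing l with the maps
   x |-> phi(x) y, for phi in Hom(P1, G), defines a map Y -> D Tr M. *)
Lemma tau_factor (M N Y : lmodType G^c) : is_tau iota M N -> hom_zero Y N ->
  exists (P1 P0 : lmodType G^c) (f : {linear P1 -> P0}) (g : {linear P0 -> M}),
    [/\ projective P0, surjective g, forall y, g y = 0 <-> exists x, f x = y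
      & forall w : {linear P1 -> Y}, exists b : {linear P0 -> Y}, forall x, b (f x) = w x].
Proof.
move=> [X [J [ev [[P1 [P0 [f [g [H0 [H1 [ev0 [ev1 [fs [q [mpp st0 st1 fsE [qs qE]]]]]]]]]]]]
  dualJ [evR evD evZ ev_inj ev_all]]]]] hom0.
have [[[k [p gen]] P1proj] [_ P0proj] [gs gE] _ _] := mpp.
exists P1, P0, f, g; split=> // w; apply: contrapT => nw.
have [io ioE cenc] := converse_rmorphism.
have [st0D st0Z st0_inj _] := st0; have [st1D st1Z st1_inj st1_all] := st1.
(* Maps from [P1] to [Y] are recorded in [V] by their values at the generators [p j]. Then [t phi y]
   is the map x |-> phi(x) y, and [W0] consists of the maps that factor through [f]. *)
pose V : lmodType R := {ffun 'I_k -> Res io Y}.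
pose t (phi : {linear P1 -> G^c^o}) (y : Y) : V := [ffun j => (phi (p j) : G^c) *: y].
pose W0 (v : V) := exists b : {linear P0 -> Y}, forall j, v j = b (f (p j)).
have sW0 : submod W0.
  split.
  - by exists \0 => j; rewrite ffunE.
  - by move=> u v [b hb] [c hc]; exists (b \+ c) => j; rewrite ffunE hb hc.
  - move=> r u [b hb].
    have [c cE] := @scale_homP R G^c io cenc P0 Y r b.
    by exists c => j; rewrite ffunE hb cE.
have [Z [pi [pis piE]]] := quot_existsP sW0.
pose wbar : V := [ffun j => w (p j)].
have wbar0 : pi wbar <> 0.
  move=> /piE [b hb]; apply: nw; exists b => x; have [a ->] := gen x.
  rewrite !linear_sum; apply: eq_bigr => j _; rewrite !linearZ; congr (_ *: _).
  by rewrite -hb ffunE.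
have [l0 l0E] := dualizing_cogenerator artR dualJ wbar0.
pose l : {linear V -> J} := l0 \o pi.
have l_W0 v : W0 v -> l v = 0 by move=> /piE e; rewrite /l /= e linear0.
have tD phi y y' : t phi (y + y') = t phi y + t phi y'.
  by apply/ffunP => j; rewrite !ffunE scalerDr.
(* For fixed [y] the pairing kills the image of [fs], as the corresponding maps factor through [P0].
   It descends to the cokernel Tr M and so defines an element of N = D Tr M. *)
have evT (y : Y) : exists n : N, forall v, ev n (q v) = l (t (ev1 v) y).
  have [||||h hE] := @linear_of_rel R (Res iota X) J
    (fun x j => exists v, q v = x /\ j = l (t (ev1 v) y)).
  - by move=> x; have [v <-] := qs x; exists (l (t (ev1 v) y)), v.
  - move=> _ _ _ _ [u [<- ->]] [v [<- ->]]; exists (u + v).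
    split; first exact: linearD.
    by rewrite -linearD; congr (l _); apply/ffunP => j; rewrite !ffunE st1D scalerDl.
  - move=> r _ _ [u [<- ->]]; exists (iota r *: u).
    split; first exact: linearZ.
    rewrite -linearZ; congr (l _); apply/ffunP => j; rewrite !ffunE st1Z.
    by rewrite restr_scaleE scalerA cenc ioE.
  - move=> _ [v [/qE [u <-] ->]]; apply: l_W0.
    have [||b bE] := @linear_ofP _ P0 Y (fun x => (ev0 u x : G^c) *: y).
    + by move=> x x'; rewrite linearD scalerDl.
    + by move=> a x; rewrite linearZ scalerA.
    by exists b => j; rewrite ffunE fsE bE.
  have [psi psiE] := @additive_ofP X J (fun x => h x) (fun x x' => linearD h x x').
  have [r x|n nE] := ev_all psi; first by rewrite !psiE; apply: (linearZ_LR h).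
  exists n => v; rewrite nE psiE; have [v' [e ->]] := hE (q v).
  have /qE [u uE] : q (v' - v) = 0 by rewrite linearB e subrr.
  apply/eqP; rewrite -subr_eq0 -linearB; apply/eqP/l_W0.
  have [||b bE] := @linear_ofP _ P0 Y (fun x => (ev0 u x : G^c) *: y).
  - by move=> x x'; rewrite linearD scalerDl.
  - by move=> a x; rewrite linearZ scalerA.
  exists b => j; rewrite !ffunE bE -fsE uE.
  have -> : ev1 v' (p j) = ev1 (v' - v) (p j) + ev1 v (p j) by rewrite -st1D subrK.
  by rewrite scalerDl; apply: addrK.
have ev0E n : (forall x, ev n x = 0) -> n = 0.
  move=> h; apply: ev_inj => x; rewrite h.
  by apply: (addrI (ev 0 x)); rewrite -evD !addr0.
have [|y y' n n' hn hn' v|a y n hn v|n hn|F FE] := @linear_of_rel _ Y N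
    (fun y n => forall v, ev n (q v) = l (t (ev1 v) y)).
- by move=> y; exact: evT.
- by rewrite evD hn hn' tD linearD.
- rewrite (evZ a) -linearZ hn; congr (l _); apply/ffunP => j; rewrite !ffunE st1Z scalerA.
  by [].
- apply: ev0E => x; have [v <-] := qs x; rewrite hn -(linear0 l); congr (l _).
  by apply/ffunP => j; rewrite !ffunE scaler0.
(* The map [F] from [Y] to [N] built from the pairing is zero by hypothesis. *)
have lt0 phi y : l (t phi y) = 0.
  have [u uE] := st1_all phi.
  have -> : t phi y = t (ev1 u) y by apply/ffunP => j; rewrite !ffunE uE.
  rewrite -FE hom0; apply: (addrI (ev 0 (q u))).
  by rewrite -evD !addr0.
(* The dual basis of [P1] writes [w] as a sum of maps of the form [t phi y], all killed by [l],
   although [l] does not kill [w]. *)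
have [phi phiE] := projective_dual_basis P1proj gen.
apply: l0E; rewrite -[l0 _]/(l wbar).
have -> : wbar = \sum_j t (phi j) (w (p j)).
  apply/ffunP => i; rewrite sum_ffunE ffunE {1}(phiE (p i)) linear_sum.
  by apply: eq_bigr => j _; rewrite ffunE linearZ.
by rewrite linear_sum big1.
Qed.

(** Lift h g to [a] on [P0]. The obstruction to descending to [M] is a map from [P1] to [Y]; it
    extends to [P0] by [tau_factor], and subtracting the extension corrects the lift. *)
Lemma tau_ext_zero (M N Y B Z : lmodType G^c) (i : {linear Y -> B}) (q : {linear B -> Z}) :
  is_tau iota M N -> hom_zero Y N -> short_exact i q ->
  forall h : {linear M -> Z}, exists h' : {linear M -> B}, forall x, q (h' x) = h x.
Proof.
move=> tauM hom0 [ii qs qE] h.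
have [P1 [P0 [f [g [P0proj gs gE fac]]]]] := tau_factor tauM hom0.
have [a aE] := P0proj _ _ q (h \o g) qs.
have [x|w wE] := @factor_inj _ _ _ _ i (a \o f) ii.
  apply/qE; rewrite /= aE /=; have -> : g (f x) = 0 by apply/gE; exists x.
  by rewrite linear0.
have [b bE] := fac w.
have [x|h' h'E] := @factor_surj _ _ _ _ g (a \- (i \o b)) gs.
  by move/gE => [z <-] /=; rewrite bE wE subrr.
exists h' => y; have [x <-] := gs y; rewrite h'E /= linearB aE /=.
have -> : q (i (b x)) = 0 by apply/qE; exists (b x).
by rewrite subr0.
Qed.

End TauRigid.

(** * Transfer to a quotient algebra *)

Section Products.
Variable A : pzRingType.
Implicit Types X Y Z : lmodType A.

Lemma iso_prod X X' Y Y' : isomorphic X X' -> isomorphic Y Y' ->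
  isomorphic (X * Y)%type (X' * Y')%type.
Proof.
move=> [f [f' fK f'K]] [g [g' gK g'K]].
have [||h hE] := @linear_ofP A (X * Y)%type (X' * Y')%type (fun u => (f u.1, g u.2)).
- by move=> x y; rewrite !linearD.
- by move=> a x; rewrite !linearZ.
exists h; exists (fun u => (f' u.1, g' u.2)) => -[x y]; rewrite ?hE /= ?fK ?gK //.
by rewrite f'K g'K.
Qed.

Lemma iso_prodA X Y Z : isomorphic ((X * Y) * Z)%type (X * (Y * Z))%type.
Proof.
have [||h hE] := @linear_ofP A ((X * Y) * Z)%type (X * (Y * Z))%type
  (fun u => (u.1.1, (u.1.2, u.2))) => //.
exists h; exists (fun u => ((u.1, u.2.1), u.2.2)) => [[[x y] z]|[x [y z]]]; by rewrite hE.
Qed.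

Lemma iso_prodC X Y : isomorphic (X * Y)%type (Y * X)%type.
Proof.
have [||h hE] := @linear_ofP A (X * Y)%type (Y * X)%type (fun u => (u.2, u.1)) => //.
by exists h; exists (fun u => (u.2, u.1)) => -[x y]; rewrite hE.
Qed.

Lemma prod_injP X Y : {i : {linear X -> (X * Y)%type} | forall x, i x = (x, 0)}.
Proof.
apply: linear_ofP => [x y|a x]; congr pair; first by rewrite addr0.
by rewrite scaler0.
Qed.

Lemma prod_fstP X Y : {p : {linear (X * Y)%type -> X} | forall u, p u = u.1}.
Proof. exact: linear_ofP. Qed.

Lemma prod_sndP X Y : {p : {linear (X * Y)%type -> Y} | forall u, p u = u.2}.
Proof. exact: linear_ofP. Qed.

Lemma short_exact_prod X Y : exists (i : {linear X -> (X * Y)%type})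
  (p : {linear (X * Y)%type -> Y}), short_exact i p.
Proof.
have [i iE] := prod_injP X Y; have [p pE] := prod_sndP X Y; exists i, p; split.
- by move=> x y; rewrite !iE => -[].
- by move=> y; exists (0, y); rewrite pE.
- move=> [x y]; rewrite pE /=; split=> [->|[x']]; first by exists x; rewrite iE.
  by rewrite iE => -[].
Qed.

Lemma direct_summand_trans X Y Z :
  direct_summand X Y -> direct_summand Y Z -> direct_summand X Z.
Proof.
move=> [X' iX] [Y' iY]; exists (X' * Y')%type; apply: iso_trans iY _.
exact: iso_trans (iso_prod iX (iso_refl _)) (iso_prodA _ _ _).
Qed.

Lemma direct_summand_maps X Y : direct_summand X Y ->
  exists (i : {linear X -> Y}) (p : {linear Y -> X}), forall x, p (i x) = x.
Proof.
move=> [N [m bm]]; have [m' mK m'K] := linear_bij_inv bm.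
have [i iE] := prod_injP X N; have [p pE] := prod_fstP X N.
by exists (m' \o i), (p \o m) => x /=; rewrite m'K iE pE.
Qed.

Lemma indecomposable_iso X Y : isomorphic X Y -> indecomposable X -> indecomposable Y.
Proof.
move=> iso [nX ind]; split=> [/(iso_zero (iso_sym iso))//|U V iU].
exact: ind (iso_trans iso iU).
Qed.

End Products.

Section Extension.
Variables (A B : pzRingType) (f : {rmorphism A -> B}).
Hypothesis fs : surjective f.

Definition killed (M : lmodType A) : Prop := forall a (x : M), f a = 0 -> a *: x = 0.

Section Def.
Variables (M : lmodType A) (kM : killed M).

Definition ext_type of surjective f & killed M : Type := M.
Local Notation N := (ext_type fs kM).

HB.instance Definition _ := GRing.Zmodule.on N.

Let rep b : A := sval (cid (fs b)).
Let repK b : f (rep b) = b. Proof. exact: (svalP (cid (fs b))). Qed.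
Let sc (b : B) (x : N) : N := rep b *: (x : M).

Let scE a (x : M) : sc (f a) x = a *: x.
Proof.
apply/eqP; rewrite -subr_eq0 -scalerBl; apply/eqP/kM.
by rewrite rmorphB repK subrr.
Qed.
Let scA a b x : sc a (sc b x) = sc (a * b) x.
Proof. by rewrite -(repK a) -(repK b) -rmorphM !scE scalerA. Qed.
Let sc1 : left_id 1 sc.
Proof. by move=> x; rewrite -(rmorph1 f) scE scale1r. Qed.
Let scDr : right_distributive sc +%R.
Proof. by move=> a x y; rewrite /sc scalerDr. Qed.
Let scDl x : {morph sc^~ x : a b / a + b}.
Proof. by move=> a b; rewrite -(repK a) -(repK b) -rmorphD !scE scalerDl. Qed.

HB.instance Definition _ := GRing.Zmodule_isLmodule.Build B N scA sc1 scDr scDl.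

Lemma extension_exists : exists N' : lmodType B, isomorphic M (Res f N').
Proof.
exists N; have [||h hE] := @linear_ofP A M (Res f N) id => //.
  by move=> a x; rewrite restr_scaleE; apply/esym/scE.
by exists h; exists id => x; rewrite hE.
Qed.

End Def.

Lemma killed_Res (M : lmodType B) : killed (Res f M).
Proof. by move=> a x fa; rewrite restr_scaleE fa scale0r. Qed.

Lemma killed_inj (M N : lmodType A) (i : {linear M -> N}) : injective i -> killed N -> killed M.
Proof. by move=> ii kN a x fa; apply: ii; rewrite linearZ linear0; apply: kN. Qed.

Lemma killed_surj (M N : lmodType A) (p : {linear M -> N}) : surjective p -> killed M -> killed N.
Proof. by move=> ps kM a y fa; have [x <-] := ps y; rewrite -linearZ kM ?linear0. Qed.

Lemma killed_iso (M N : lmodType A) : isomorphic M N -> killed M -> killed N.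
Proof. by move=> [h /bij_surj]; apply: killed_surj. Qed.

Lemma linear_unRes (M N : lmodType B) (h : {linear Res f M -> Res f N}) :
  {g : {linear M -> N} | forall x : M, g x = h x}.
Proof.
apply: (@linear_ofP B M N (fun x => h x)) => [x y|b x]; first exact: (linearD h x y).
by have [a <-] := cid (fs b); apply: (linearZ_LR h a x).
Qed.

Lemma iso_Res (M N : lmodType B) : isomorphic M N -> isomorphic (Res f M) (Res f N).
Proof.
move=> [h bh]; have [g gE] := linear_Res f h; exists g.
by apply: (eq_bij bh) => x; rewrite gE.
Qed.

Lemma iso_unRes (M N : lmodType B) : isomorphic (Res f M) (Res f N) -> isomorphic M N.
Proof.
move=> [h bh]; have [g gE] := linear_unRes h; exists g.
by apply: (eq_bij bh) => x; rewrite gE.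
Qed.

Lemma Res_prod (M N : lmodType B) :
  isomorphic (Res f (M * N)%type) (Res f M * Res f N)%type.
Proof.
have [||h hE] := @linear_ofP A (Res f (M * N)%type) (Res f M * Res f N)%type id => //.
by exists h; exists id => x; rewrite hE.
Qed.

(** Summands of a module killed by the kernel of [f] are killed as well, so every decomposition over
    [A] comes from one over [B]. *)
Lemma indecomposable_Res (M : lmodType B) : indecomposable M <-> indecomposable (Res f M).
Proof.
split=> -[nM ind]; split=> // X Y.
  move=> iso; have [i [p ex]] := short_exact_prod X Y.
  have [p1 p1E] := prod_fstP X Y.
  have kXY : killed (X * Y)%type by apply: killed_iso iso (@killed_Res M).
  have [X' iX] : exists X', isomorphic X (Res f X').
    by apply: extension_exists; apply: killed_inj kXY; case: ex => ii _ _; apply: ii.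
  have [Y' iY] : exists Y', isomorphic Y (Res f Y').
    by apply: extension_exists; apply: killed_surj kXY; case: ex => _ ps _; apply: ps.
  have [|X0|Y0] := ind X' Y'; [|left|right].
  - apply: iso_unRes; apply: iso_trans (iso_sym (Res_prod _ _)).
    exact: iso_trans iso (iso_prod iX iY).
  - by apply: (iso_zero (iso_sym iX)) => x; apply: X0.
  - by apply: (iso_zero (iso_sym iY)) => x; apply: Y0.
move=> iso; have [|X0|Y0] := ind (Res f X) (Res f Y); [|by left|by right].
exact: iso_trans (iso_Res iso) (Res_prod _ _).
Qed.

Lemma direct_summand_Res (M N : lmodType B) :
  direct_summand M N -> direct_summand (Res f M) (Res f N).
Proof. by move=> [M' iso]; exists (Res f M'); apply: iso_trans (iso_Res iso) (Res_prod _ _). Qed.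

Lemma direct_summand_ext (M : lmodType A) (N : lmodType B) : direct_summand M (Res f N) ->
  exists M' : lmodType B, isomorphic M (Res f M') /\ direct_summand M' N.
Proof.
move=> [M1 iso]; have kP : killed (M * M1)%type by apply: killed_iso iso (@killed_Res N).
have [i [p [ii ps _]]] := short_exact_prod M M1.
have [M' iM] := extension_exists (killed_inj ii kP).
have [M1' iM1] := extension_exists (killed_surj ps kP).
exists M'; split=> //; exists M1'; apply: iso_unRes.
exact: iso_trans iso (iso_trans (iso_prod iM iM1) (iso_sym (Res_prod _ _))).
Qed.

Lemma num_indec_summands_Res (T : lmodType A) (T' : lmodType B) n : isomorphic T (Res f T') ->
  num_indec_summands T' n -> num_indec_summands T n.
Proof.
move=> isoT [s [sP sinj sall]]; exists (fun i => Res f (s i)); split.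
- move=> i; have [ind sum] := sP i; split; first exact/indecomposable_Res.
  have [N iso] := direct_summand_Res sum.
  by exists N; apply: iso_trans isoT iso.
- by move=> i j /iso_unRes /sinj.
- move=> M [ind [N iso]].
  have [|M' [isoM sumM]] := @direct_summand_ext M T'.
    by exists N; apply: iso_trans (iso_sym isoT) iso.
  have [|i isoi] := sall M'.
    by split=> //; apply/indecomposable_Res; apply: indecomposable_iso ind.
  by exists i; apply: iso_trans isoM (iso_Res isoi).
Qed.

(** * Simple modules and indecomposable summands of the regular module *)

Section Simples.
Variables (R : comPzRingType) (io : {rmorphism R -> B}).
Hypothesis flB : forall M : lmodType B, fin_gen M -> fl io M.
Variables (n : nat) (s : 'I_n -> lmodType B).
Hypothesis s_sum : forall i, indecomposable (s i) /\ direct_summand (s i) (B^o : lmodType B).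
Hypothesis s_all : forall M : lmodType B,
  indecomposable M /\ direct_summand M (B^o : lmodType B) -> exists i, isomorphic M (s i).

(** As [s a] is an indecomposable projective, this says that [Z] is its top; it labels simple
    modules by the summands [s a]. *)
Definition top_of (Z : lmodType A) (a : 'I_n) : Prop :=
  exists phi : {linear Res f (s a) -> Z}, surjective phi.

Let fl_summand (Q : lmodType B) : direct_summand Q (B^o : lmodType B) -> fl io Q.
Proof.
move=> /direct_summand_maps [i [p pi]]; apply: (fl_surj (f := p)) => [x|].
  by exists (i x).
apply: flB; exists 1%N, (fun _ => 1) => x; exists (fun _ => x).
by rewrite big_ord1; apply/esym/mulr1.
Qed.

Lemma simple_hom_surj (M Z : lmodType A) (phi : {linear M -> Z}) x :
  simple_module Z -> phi x <> 0 -> surjective phi.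
Proof.
move=> [_ sZ] nx; case: (sZ _ (submod_range phi)) => // h.
by case: nx; apply: h; exists x.
Qed.

(** Among summands of the regular module with a nonzero map to [Z], one of least length is
    indecomposable; the regular module itself is a candidate. *)
Lemma top_of_exists (Z : lmodType A) : simple_module Z -> killed Z -> exists a, top_of Z a.
Proof.
move=> sZ kZ; have [Z' [e be]] := extension_exists kZ.
have [e' eK e'K] := linear_bij_inv be.
pose P m := `[< exists Q : lmodType B, [/\ direct_summand Q (B^o : lmodType B),
  exists (phi : {linear Res f Q -> Z}) (x : Q), phi x <> 0 & mlen io Q = m] >].
have exP : exists m, P m.
  have [z z0] : exists z : Z, z <> 0.
    by case: sZ => nZ _; apply: contrapT => h; apply: nZ => z; apply: contrapT => hz; apply: h; exists z.
  have [g gE] := scale_linearP (e z : Z'); have [g' g'E] := linear_Res f g.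
  exists (mlen io (B^o : lmodType B)); apply/asboolP; exists (B^o : lmodType B); split=> //.
    have U0 := submod0 (B^o : lmodType B).
    have [U [i [ii iE]]] := sub_existsP U0; exists U.
    have [j jE] := prod_injP (B^o : lmodType B) U; exists j; apply: inj_surj_bij.
      by move=> x y; rewrite !jE => -[].
    move=> [x u]; exists x; rewrite jE; congr pair; apply: ii; rewrite linear0.
    by apply/esym/iE; exists u.
  exists (e' \o g'), (1 : B) => /= h; apply: z0; rewrite -(eK z).
  by apply: etrans h; congr (e' _); rewrite g'E gE scale1r.
have [m /asboolP [Q [sumQ [phi [x nx]] <-]] mmin] := ex_minnP exP.
have indQ : indecomposable Q.
  split=> [Q0|X Y isoXY]; first by apply: nx; rewrite (Q0 x : x = 0) linear0.
  (* If [phi] is nonzero on a summand [X'] of [Q], minimality leaves length 0 for the complement. *)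
  have shrink (X' Y' : lmodType B) (i : {linear X' -> Q}) y : isomorphic Q (X' * Y')%type ->
      phi (i y) <> 0 -> zero_module Y'.
    move=> iso ny; have sumX : direct_summand X' Q by exists Y'.
    have sumX' := direct_summand_trans sumX sumQ.
    have [i' i'E] := linear_Res f i.
    have /mmin : P (mlen io X').
      by apply/asboolP; exists X'; split=> //; exists (phi \o i'), y; rewrite /= i'E.
    have sumY : direct_summand Y' Q by exists X'; apply: iso_trans iso (iso_prodC _ _).
    have sumY' := direct_summand_trans sumY sumQ.
    have [u [v ex]] := short_exact_prod X' Y'.
    have flXY := fl_iso iso (fl_summand sumQ).
    rewrite (mlen_iso (fl_summand sumQ) iso) (mlen_short_exact (fl_summand sumX') flXY ex).
    rewrite -[X in (_ <= X)%N]addn0 leq_add2l leqn0 => /eqP.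
    exact: (mlen_eq0 (fl_summand sumY')).
  have isoYX := iso_trans isoXY (iso_prodC _ _).
  have [d bd] := isoXY; have [d' dK d'K] := linear_bij_inv bd.
  have [i iE] := prod_injP X Y.
  have [||j jE] := @linear_ofP B Y (X * Y)%type (fun y => (0, y)).
  - by move=> y y'; congr pair; rewrite addr0.
  - by move=> a y; congr pair; rewrite scaler0.
  have [h|h] := EM (phi (d' (i (d x).1)) = 0); last first.
    by right; apply: (shrink _ _ (d' \o i) (d x).1).
  left; apply: (shrink _ _ (d' \o j) (d x).2) => //= h'; apply: nx.
  have -> : x = d' (i (d x).1) + d' (j (d x).2).
    rewrite -linearD iE jE -{1}(dK x); congr (d' _); case: (d x) => u v.
    by congr pair; rewrite /= ?addr0 ?add0r.
  by apply: etrans (linearD phi _ _) _; rewrite h h' addr0.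
have [a iso] := s_all (conj indQ sumQ); have [k bk] := iso_Res (iso_sym iso).
exists a; exists (phi \o k); have [y ky] := bij_surj bk x.
by apply: (@simple_hom_surj _ _ _ y) => //=; rewrite ky.
Qed.

(** If [phi] and [psi] had different kernels, some endomorphism [e] of [s a] would satisfy phi e = 0
    and psi e = psi. Fitting's lemma excludes it: bijective [e] gives phi = 0, nilpotent [e] gives
    psi = 0. *)
Lemma top_of_iso (Z Z' : lmodType A) a : simple_module Z -> simple_module Z' ->
  top_of Z a -> top_of Z' a -> isomorphic Z Z'.
Proof.
move=> sZ sZ' [phi phis] [psi psis].
have [nZ simZ] := sZ; have [nZ' simZ'] := sZ'.
have [sub|nsub] := EM (forall x, phi x = 0 -> psi x = 0).
  have [g gE] := factor_surj phis sub; exists g; apply: inj_surj_bij.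
    apply: linear_inj0 => z gz; case: (simZ _ (submod_ker g)) => h; first exact: h.
    case: nZ' => z'; have [x <-] := psis z'.
    by rewrite -gE h.
  by move=> z'; have [x <-] := psis z'; exists (phi x); rewrite gE.
have [x1 [phi1 psi1]] : exists x, phi x = 0 /\ psi x <> 0.
  apply: contrapT => h; apply: nsub => x px; apply: contrapT => nx; apply: h.
  by exists x.
have [ind sum] := s_sum a; have fP := fl_summand sum.
have [j [p pj]] := direct_summand_maps sum.
pose P : lmodType B := s a.
have pE (b : B) : p b = b *: p 1.
  by rewrite -linearZ; congr (p _); apply/esym/mulr1.
have [x [phx psx]] : exists x : P, phi x = 0 /\ psi x = psi (p 1).
  have [|h|h] := simZ' (fun z => exists2 x, phi x = 0 & psi x = z).
  - exact: submod_img (submod_ker phi).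
  - by case: psi1; apply: h; exists x1.
  - by have [x ? ?] := h (psi (p 1)); exists x.
(* Every [y] is (j y) p(1); [e] replaces the generator [p 1] by [x], which [psi] does not
   distinguish from it and which [phi] kills. *)
have [||e eE] := @linear_ofP B P P (fun y => (j y : B) *: x).
- by move=> y y'; rewrite linearD scalerDl.
- by move=> b y; rewrite linearZ scalerA.
have phe y : phi (e y) = 0.
  rewrite eE; have [b <-] := fs (j y).
  by apply: etrans (linearZ_LR phi b x) _; rewrite phx scaler0.
have pse y : psi (e y) = psi y.
  rewrite eE -{2}(pj y) pE; have [b <-] := fs (j y).
  apply: etrans (linearZ_LR psi b x) _; rewrite psx.
  exact: (esym (linearZ_LR psi b (p 1))).
exfalso; have [be|[k nil]] := @fitting _ _ _ _ e fP ind.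
  by apply: nZ => z; have [y <-] := phis z; have [y' <-] := bij_surj be y; apply: phe.
apply: nZ' => z; have [y <-] := psis z.
have -> : psi y = psi (iter k e y) by elim: k {nil} => //= k; rewrite pse.
by rewrite nil linear0.
Qed.

End Simples.
End Extension.

Lemma finite_algebra_fl (R : comPzRingType) (A : pzRingType) (io : {rmorphism R -> A}) :
  artinian R ->
  (exists (n : nat) (v : 'I_n -> A), forall x, exists r : 'I_n -> R, x = \sum_i io (r i) * v i) ->
  forall M : lmodType A, fin_gen M -> fl io M.
Proof.
move=> artR [n [a ga]] M [m [v gv]].
apply: fin_gen_fin_len (artinian_fin_len artR) _.
apply: (@fin_gen_finType _ (Res io M) ('I_m * 'I_n)%type (fun k => a k.2 *: v k.1)) => x.
have [b ->] := gv x; have [r rE] := choice (fun j => ga (b j)).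
exists (fun k => r k.1 k.2).
rewrite -(pair_bigA _ (fun j i => r j i *: (a i *: v j : Res io M))) /=.
apply: eq_bigr => j _; rewrite {1}rE scaler_suml; apply: eq_bigr => i _.
by rewrite restr_scaleE scalerA.
Qed.

Lemma converse_map (L G : pzRingType) (p : {rmorphism L -> G}) :
  {pc : {rmorphism L^c -> G^c} | forall a : L, pc a = p a :> G}.
Proof.
have m1 : monoid_morphism (p : L^c -> G^c).
  split=> [|x y]; first exact: (rmorph1 p).
  exact: (rmorphM p (y : L) (x : L)).
pose pc : {rmorphism L^c -> G^c} := HB.pack (p : L^c -> G^c)
  (GRing.isZmodMorphism.Build L^c G^c (p : L^c -> G^c) (rmorphB p))
  (GRing.isMonoidMorphism.Build L^c G^c (p : L^c -> G^c) m1).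
by exists pc.
Qed.

Lemma converse_generated (R : comPzRingType) (L : pzRingType) (iota : {rmorphism R -> L})
    (io : {rmorphism R -> L^c}) :
  (forall r a, iota r * a = a * iota r) -> (forall r, io r = iota r :> L) ->
  (exists (n : nat) (v : 'I_n -> L), forall x, exists r : 'I_n -> R, x = \sum_i iota (r i) * v i) ->
  exists (n : nat) (v : 'I_n -> L^c), forall x, exists r : 'I_n -> R, x = \sum_i io (r i) * v i.
Proof.
move=> cen ioE [n [v gv]]; exists n, v => x; have [r rE] := gv x; exists r.
apply: etrans rE _; apply: eq_bigr => i _; rewrite cen ioE.
by [].
Qed.

Lemma killed_Fac (A B : pzRingType) (f : {rmorphism A -> B}) (T X : lmodType A) :
  killed f T -> Fac T X -> killed f X.
Proof.
move=> kT [n [g gs]]; apply: (killed_surj gs) => a u fa.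
by apply/ffunP => i; rewrite !ffunE kT.
Qed.

Lemma Fac_hom_zero (A : pzRingType) (T X N : lmodType A) :
  hom_zero T N -> Fac T X -> hom_zero X N.
Proof.
move=> h0 [n [g gs]] h x; have [u <-] := gs x.
have ex j : exists d : {linear T -> {ffun 'I_n -> T}}, forall t, d t = [ffun i => if i == j then t else 0].
  have [||d dE] := @linear_ofP A T {ffun 'I_n -> T} (fun t => [ffun i => if i == j then t else 0]).
  - by move=> x1 y; apply/ffunP => i; rewrite !ffunE; case: eqP => // _; rewrite addr0.
  - by move=> a y; apply/ffunP => i; rewrite !ffunE; case: eqP => // _; rewrite scaler0.
  by exists d.
have [d dE] := choice ex.
have -> : u = \sum_j d j (u j).
  apply/ffunP => i; rewrite sum_ffunE (bigD1 i) //= dE ffunE eqxx big1 ?addr0 // => j ji.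
  by rewrite dE ffunE eq_sym (negbTE ji).
by rewrite !linear_sum big1 // => j _; apply: (h0 (h \o g \o d j)).
Qed.

(** * Ext-projectivity of T in Fac T *)

Section ExtProjective.
Variables (R : comPzRingType) (L G : pzRingType) (iota : {rmorphism R -> G}).
Variables (pc : {rmorphism L^c -> G^c}) (T : lmodType L^c) (T' N : lmodType G^c).
Hypothesis artR : artinian R.
Hypothesis cen : forall r a, iota r * a = a * iota r.
Hypothesis pcs : surjective pc.
Hypothesis isoT : isomorphic T (Res pc T').
Hypothesis tauN : is_tau iota T' N.
Hypothesis rigid : hom_zero T' N.

Let hom_zero_Fac (Y : lmodType L^c) (Y' : lmodType G^c) :
  Fac T Y -> isomorphic Y (Res pc Y') -> hom_zero Y' N.
Proof.
move=> FY [e be] h y'; have [h1 h1E] := linear_Res pc h.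
have [t bt] := isoT.
have T0 : hom_zero T (Res pc N).
  move=> g x; have [u tu ut] := linear_bij_inv bt.
  have [g' g'E] := linear_unRes pcs (g \o u).
  by rewrite -(tu x) -[LHS]/((g \o u) (t x)) -g'E rigid.
have [y <-] := bij_surj be y'.
exact: etrans (esym (h1E _)) (Fac_hom_zero T0 FY (h1 \o e) y).
Qed.

(** All terms are killed by the kernel of [pc], so the sequence and [h] transfer to [G], where
    tau-rigidity yields the lift; the lift is then restricted back. *)
Lemma Fac_ext_projective (Y B Z : lmodType L^c) (i : {linear Y -> B}) (q : {linear B -> Z}) :
  Fac T Y -> Fac T B -> short_exact i q ->
  forall h : {linear T -> Z}, exists h' : {linear T -> B}, forall x, q (h' x) = h x.
Proof.
move=> FY FB [ii qs qE] h.
have kT : killed pc T by apply: killed_iso (iso_sym isoT) (@killed_Res _ _ pc T').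
have kB := killed_Fac kT FB; have kZ := killed_surj qs kB.
have [Y' iY] := extension_exists pcs (killed_Fac kT FY).
have [B' iB] := extension_exists pcs kB.
have [Z' iZ] := extension_exists pcs kZ.
have Y0 := hom_zero_Fac FY iY.
have [t bt] := isoT; have [t1 tK t1K] := linear_bij_inv bt.
have [y by_] := iY; have [y1 yK y1K] := linear_bij_inv by_.
have [b bb] := iB; have [b1 bK b1K] := linear_bij_inv bb.
have [z bz] := iZ; have [z1 zK z1K] := linear_bij_inv bz.
have [i' i'E] := linear_unRes pcs (b \o i \o y1).
have [q' q'E] := linear_unRes pcs (z \o q \o b1).
have [h' h'E] := linear_unRes pcs (z \o h \o t1).
have ex : short_exact i' q'.
  split.
  - move=> u v; rewrite !i'E /= => /(bij_inj bb) /ii e.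
    by rewrite -(y1K u) -(y1K v) e.
  - move=> u; have [w wE] := qs (z1 u); exists (b w).
    by rewrite q'E /= bK wE z1K.
  - move=> u; rewrite q'E /=; split=> [e|[w <-]].
      have /qE [v vE] : q (b1 u) = 0 by apply: (bij_inj bz); rewrite linear0.
      by exists (y v); rewrite i'E /= yK vE b1K.
    rewrite i'E /= bK; have -> : q (i (y1 w)) = 0 by apply/qE; exists (y1 w).
    exact: linear0.
have [k kE] := tau_ext_zero artR cen tauN Y0 ex h'.
have [k' k'E] := linear_Res pc k.
exists (b1 \o k' \o t) => x /=; apply: (bij_inj bz); rewrite k'E.
have := kE (t x); rewrite q'E h'E /= tK.
by [].
Qed.

End ExtProjective.

Theorem corollary5p15 (R : comPzRingType) (L : pzRingType)
    (iota : {rmorphism R -> L}) (hL : artin_algebra iota)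
    (T : lmodType L^c) (hT : support_tau_tilting iota T)
    (C : lmodType L^c -> Prop)
    (hC : torsion_class C) (hff : functorially_finite C)
    (hCT : forall X : lmodType L^c, C X <-> Fac T X) :
  JHP C <->
  exists n : nat, num_iso_classes (simple_object C) n /\ num_indec_summands T n.
Proof.
have [artR cen gen] := hL.
have [e [_ [G [p [T' [ps _ [h0 [bh hsc]] [[fgT' [N [tauN rigid]]] [n [nT' nG]]]]]]]]] := hT.
have [F tor] := hC.
have Cquot (X Y : lmodType L^c) (q : {linear X -> Y}) : surjective q -> C X -> C Y.
  move=> qs /hCT [k [g gs]]; apply/hCT; exists k, (q \o g) => y.
  by have [x <-] := qs y; have [u <-] := gs x; exists u.
have [io ioE ioC] := converse_rmorphism cen.
have fgfl := finite_algebra_fl artR (converse_generated cen ioE gen).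
have cenG r a : (p \o iota) r * a = a * (p \o iota) r.
  by have [b <-] := ps a; rewrite /= -!rmorphM cen.
have genG : exists (k : nat) (v : 'I_k -> G), forall x, exists r : 'I_k -> R,
    x = \sum_i (p \o iota) (r i) * v i.
  have [k [v gv]] := gen; exists k, (fun i => p (v i)) => x; have [y <-] := ps x.
  have [r ->] := gv y; exists r; rewrite rmorph_sum; apply: eq_bigr => i _.
  by rewrite rmorphM.
have [ioG ioGE _] := converse_rmorphism cenG.
have fgflG := finite_algebra_fl artR (converse_generated cenG ioGE genG).
have [pc pcE] := converse_map p.
have pcs : surjective pc by move=> y; have [x <-] := ps y; exists x; rewrite pcE.
have isoT : isomorphic T (Res pc T').
  have [||h hE] := @linear_ofP _ T (Res pc T') h0.
  - exact: raddfD.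
  - by move=> a x; rewrite hsc restr_scaleE pcE.
  by exists h; apply: (eq_bij bh) => x; rewrite hE.
have kT : killed pc T by apply: killed_iso (iso_sym isoT) (@killed_Res _ _ pc T').
have nT := num_indec_summands_Res pcs isoT nT'.
have CT : C T.
  apply/hCT; exists 1%N; have [||g gE] := @linear_ofP _ {ffun 'I_1 -> T} T (fun u => u ord0).
  - by move=> x y; rewrite ffunE.
  - by move=> a x; rewrite ffunE.
  by exists g => x; exists [ffun => x]; rewrite gE ffunE.
have dual m (s : 'I_m -> lmodType L^c) :
    (forall i, indecomposable (s i) /\ direct_summand (s i) T) ->
    (forall i j, isomorphic (s i) (s j) -> i = j) ->
    [/\ forall j, additive_on C (hl io (s j)), forall i, C (s i)
    & forall i, exists X Y, [/\ C X, C Y,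
        forall j, i <> j -> (hl io (s j) (s i) + hl io (s j) Y = hl io (s j) X)%N
      & (hl io (s i) X < hl io (s i) (s i) + hl io (s i) Y)%N]].
  move=> sP sinj.
  have Cs i : C (s i).
    have [a [b ab]] := direct_summand_maps (sP i).2.
    by apply: (Cquot _ _ b) CT => x; exists (a x).
  have gs i : fin_gen (s i) by case: tor => Cfg _ _ _; apply: Cfg.
  split=> // [j X Y Z f g CX CZ ex|i].
    have CY := E_ext fgfl tor Cquot ex CX CZ.
    apply: (hl_short_exact ioC (E_fl fgfl tor CY) (gs j) ex) => h.
    (* Lifting along [g] holds for [T] and passes to its retract [s j]. *)
    have [a [b ab]] := direct_summand_maps (sP j).2.
    have [h' h'E] := Fac_ext_projective artR cenG pcs isoT tauN rigid
      ((hCT X).1 CX) ((hCT Y).1 CY) ex (h \o b).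
    by exists (h' \o a) => x /=; rewrite /= h'E /= ab.
  apply: (@hom_dual_basis _ _ _ ioC m s C _ _ sinj Cs _ F) => // [j|j|X Y CX CY].
  - exact: (E_fl fgfl tor).
  - by case: (sP j).
  - exact: (E_prod fgfl tor Cquot).
split=> [jhp|[m [[S [sS injS allS]] [s [sP sinj sall]]]]]; last first.
  have [add Cs dl] := dual m s sP sinj.
  exact: (JHP_of_dual fgfl tor Cquot injS allS add Cs dl).
(* By tau-tilting, the same [n] counts the indecomposable summands of [T'] and of the regular module
   of [G]; the latter serve as labels. *)
have [P [sP injP allP]] := nG.
have [N' [S [sS injS allS]] le] : exists2 N', num_iso_classes (simple_object C) N' & (N' <= n)%N.
  apply: num_iso_classes_bounded => k S sS injS.
  have [phi [add phiE]] := JHP_multiplicity fgfl tor Cquot S jhp.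
  apply: (additive_rank_bound fgfl tor Cquot (K := top_of pc P) (S := S) _ _ add).
  (* A simple submodule of an object of Fac T is killed by the kernel of [pc], so it is a simple
     [G]-module and has a label. *)
  - move=> Z X i sZ /hCT FX ii; apply: (top_of_exists pcs fgflG allP sZ).
    exact: killed_inj ii (killed_Fac kT FX).
  - by move=> Z Z' a sZ sZ'; apply: (top_of_iso pcs fgflG sP).
  - by move=> l; case: (sS l).
  - move=> a l; rewrite phiE // /cls; congr nat_of_bool.
    by apply/asboolP/eqP => [/injS ->|->] //; exact: iso_refl.
exists n; split=> //.
have [s [sumS sinj _]] := nT.
have [add Cs dl] := dual n s sumS sinj.
(* The opposite inequality comes from the independence of the Hom-length functions. *)
have ge := dual_rank fgfl tor Cquot injS allS add Cs dl.
have -> : n = N' by apply/eqP; rewrite eqn_leq ge.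
by exists S.
Qed.
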